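(* There is a real constant $C>0$ such that the following holds. Let $f=(f_n)_{n\ge 1}$ be an $L^1(T)$-bounded martingale with respect to the filtration $(T_n)_{n\ge 1}$. Then for every real $\lambda>0$ there exist three martingales $u=(u_n)_{n\ge1}$, $v=(v_n)_{n\ge1}$, $w=(w_n)_{n\ge1}$ with respect to $(T_n)_{n\ge 1}$ such that $f=u+v+w$ and: (i) $u$ is $L^1(T)$-bounded, $\|u\|_1\le C\|f\|_1$, and $\lambda\, T P_{\Delta u^*}e\le C\|f\|_1$; (ii) $v_n=\sum_{k=1}^n\Delta v_k$ is absolutely convergent and $\left\|\sum_{k=1}^\infty|\Delta v_k|\right\|_1\le C\|f\|_1$; (iii) $w$ is uniformly bounded, $\|w\|_\infty\le C\lambda e$, $\|w\|_1\le C\|f\|_1$ and $\|w\|_2^2\le C\lambda\|f\|_1$.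
   Context: $E$ is a Dedekind complete Riesz space with weak order unit $e>0$. A conditional expectation on $E$ is a strictly positive order-continuous linear projection $S:E\to E$ whose range $R(S)$ is a Dedekind complete Riesz subspace of $E$ and with $Se=e$. A filtration is a sequence $(T_i)_{i\ge1}$ of conditional expectations with $T_iT_j=T_jT_i=T_j$ for $j\le i$; put $T=T_1$. $E_u$ is the universal completion of $E$, with its $f$-algebra structure in which $e$ is the multiplicative unit. $E_s$ is the sup-completion of $E$: the unique Dedekind complete ordered cone with a largest element containing $E$ as the sub-cone equal to its group of invertible elements, such that $x=\sup\{g\in E: g\le x\}$ for $x\in E_s$; positive elements of $E_u$ are regarded as elements of $E_s$. For $x\in E_s$ positive, $Tx:=\sup_\alpha Tx_\alpha\in E_s$ for any increasing net $(x_\alpha)$ in $E^+$ with $x_\alpha\uparrow x$. $L^1(T)$ is the natural domain of $T$: the $x\in E_u$ with $T|x|\in E_u$; it is a Dedekind complete Riesz space with weak order unit $e$, and $T$ and all $T_i$ extend to conditional expectations on $L^1(T)$ (same notation; $R(T)$, $R(T_i)$ denote the ranges of the extensions). For $1\le p<\infty$, $L^p(T)=\{x\in L^1(T):|x|^p\in L^1(T)\}$ and $\|x\|_p=(T|x|^p)^{1/p}$; $L^\infty(T)=\{x\in L^1(T):|x|\le r\text{ for some }r\in R(T)\}$ and $\|x\|_\infty=\inf\{r\in R(T):|x|\le r\}$. Also $\|x\|_1=Tx$ for positive $x\in E_s$. A martingale is a sequence $f=(f_n)_{n\ge1}$ in $L^1(T)$ with $f_n\in R(T_n)$ and $T_if_j=f_i$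 for $i\le j$. Put $\Delta f_1=f_1$, $\Delta f_n=f_n-f_{n-1}$ $(n\ge2)$, and $\|f\|_p=\sup_n\|f_n\|_p\in E_s$ for $p\in[1,\infty]$. $f$ is $L^1(T)$-bounded if $\sup_nT|f_n|$ exists in $L^1(T)$. $\Delta u^*:=\sup_n|\Delta u_n|\in E_s$. For a positive $x\in E$ (or $x\in E_s$), $P_x$ is the band projection of $E$ onto the band generated by $x$ (respectively by $\{g\in E:0\le g\le x\}$). A martingale $v$ is absolutely convergent if $\sum_{k=1}^\infty|\Delta v_k|$ converges in order in $L^1(T)$. *)

(* Defs.v *)
From HB Require Import structures.
From mathcomp Require Import all_boot all_order all_algebra.
From mathcomp Require Import boolp classical_sets reals.

Set Implicit Arguments.
Unset Strict Implicit.
Unset Printing Implicit Defensive.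

Import Order.TTheory GRing.Theory Num.Theory.
Local Open Scope classical_set_scope.
Local Open Scope ring_scope.

(* Lattice operations are fields rather than inherited from latticeType: the
   library makes realDomainType the only join of zmodType and latticeType.
   For the same reason the product of an f-algebra and the operations of an
   ordered cone are fields below. *)
HB.mixin Record POrderedZmodule_isRiesz (R : numDomainType) E
    of GRing.Lmodule R E & Num.POrderedZmodule E := {
  rler_wD2r : forall z x y : E, x <= y -> x + z <= y + z;
  rscaler_ge0 : forall (a : R) (x : E), 0 <= a -> 0 <= x -> 0 <= a *: x;
  rjoin : E -> E -> E;
  rmeet : E -> E -> E;
  rjoin_le : forall x y z : E, (rjoin x y <= z) = (x <= z) && (y <= z);
  rmeet_ge : forall x y z : E, (z <= rmeet x y) = (z <= x) && (z <= y)
}.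

#[short(type="rieszType")]
HB.structure Definition Riesz (R : numDomainType) :=
  { E of GRing.Lmodule R E & Num.POrderedZmodule E
       & POrderedZmodule_isRiesz R E }.

HB.mixin Record Riesz_isFAlgebra (R : numDomainType) A of Riesz R A := {
  fone : A;
  fmul : A -> A -> A;
  fmulA : forall x y z, fmul x (fmul y z) = fmul (fmul x y) z;
  fmul1l : forall x, fmul fone x = x;
  fmul1r : forall x, fmul x fone = x;
  fmulDl : forall (a : R) x y z, fmul (a *: x + y) z = a *: fmul x z + fmul y z;
  fmulDr : forall (a : R) x y z, fmul z (a *: x + y) = a *: fmul z x + fmul z y;
  fmul_ge0 : forall x y : A, 0 <= x -> 0 <= y -> 0 <= fmul x y;
  fmull_disjoint : forall x y z : A,
    rmeet x y = 0 -> 0 <= z -> rmeet (fmul z x) y = 0;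
  fmulr_disjoint : forall x y z : A,
    rmeet x y = 0 -> 0 <= z -> rmeet (fmul x z) y = 0
}.

#[short(type="fAlgType")]
HB.structure Definition FAlgebra (R : numDomainType) :=
  { A of Riesz R A & Riesz_isFAlgebra R A }.

(* Scalars of a cone are nonnegative: [cscale a] is only specified for a >= 0. *)
HB.mixin Record POrder_isOrderedCone (R : numDomainType) C
    of Order.POrder ring_display C := {
  czero : C;
  cadd : C -> C -> C;
  cscale : R -> C -> C;
  caddA : associative cadd;
  caddC : commutative cadd;
  cadd0 : left_id czero cadd;
  cscaleDr : forall a x y, 0 <= a ->
    cscale a (cadd x y) = cadd (cscale a x) (cscale a y);
  cscaleDl : forall a b x, 0 <= a -> 0 <= b ->
    cscale (a + b) x = cadd (cscale a x) (cscale b x);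
  cscaleA : forall a b x, 0 <= a -> 0 <= b ->
    cscale (a * b) x = cscale a (cscale b x);
  cscale1 : forall x, cscale 1 x = x;
  cscale0 : forall x, cscale 0 x = czero;
  cle_wD2r : forall z x y : C, x <= y -> cadd x z <= cadd y z;
  cle_scale : forall a (x y : C), 0 <= a -> x <= y -> cscale a x <= cscale a y
}.

#[short(type="orderedConeType")]
HB.structure Definition OrderedCone (R : numDomainType) :=
  { C of Order.POrder ring_display C & POrder_isOrderedCone R C }.
Arguments czero {R s}.

Section RelativeOrder.
Context {d : Order.disp_t} {X : porderType d}.
Implicit Types A D : set X.

Definition supremums_in A D : set X :=
  [set s | A s /\ ubound D s /\ forall t, A t -> ubound D t -> (s <= t)%O].

Definition infimums_in A D : set X :=
  [set s | A s /\ lbound D s /\ forall t, A t -> lbound D t -> (t <= s)%O].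

Definition dedekind_complete A := forall D, D `<=` A -> D !=set0 ->
  (exists2 b, A b & ubound D b) -> supremums_in A D !=set0.

End RelativeOrder.

Definition directed (I : Type) (le : I -> I -> Prop) :=
  [/\ exists i : I, True, forall i, le i i,
      forall i j k, le i j -> le j k -> le i k &
      forall i j, exists2 k, le i k & le j k].

Section RieszSpaces.
Context {R : realType} {E : rieszType R}.
Implicit Types (x y : E) (A B D : set E) (S : E -> E).

Definition rpos x : E := rjoin x 0.
Definition rneg x : E := rjoin (- x) 0.
Definition rabs x : E := rjoin x (- x).

Definition rdisjoint x y := rmeet (rabs x) (rabs y) = 0.

Definition riesz_subspace A :=
  [/\ A 0, forall (a : R) x y, A x -> A y -> A (a *: x + y) &
      forall x y, A x -> A y -> A (rjoin x y)].

Definition ideal A :=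
  [/\ A 0, forall (a : R) x y, A x -> A y -> A (a *: x + y) &
      forall x y, A y -> rabs x <= rabs y -> A x].

Definition band B :=
  ideal B /\ forall D s, D `<=` B -> supremums D s -> B s.

Definition band_generated D : set E :=
  [set x | forall B, band B -> D `<=` B -> B x].

Definition disjoint_complement B : set E :=
  [set x | forall y, B y -> rdisjoint x y].

(* The component of x in B for the decomposition of E as the direct sum of B
   and its disjoint complement; it exists for every band when E is Dedekind
   complete. *)
Definition band_proj B x : E :=
  xget 0 [set b | B b /\ disjoint_complement B (x - b)].

Definition weak_order_unit (e : E) := 0 < e /\ band_generated [set e] = setT.

Definition order_cvg_in A (I : Type) (le : I -> I -> Prop) (x : I -> E)
    (l : E) :=
  A l /\ exists y : I -> E,
    [/\ forall i, A (y i), forall i j, le i j -> y j <= y i,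
        infimums_in A (range y) 0 & forall i, rabs (x i - l) <= y i].

Definition order_continuous S :=
  forall (I : Type) (le : I -> I -> Prop) (x : I -> E) (l : E),
    directed le -> order_cvg_in setT le x l ->
    order_cvg_in setT le (S \o x) (S l).

Definition conditional_expectation (e : E) (S : {linear E -> E}) :=
  [/\ forall x, 0 < x -> 0 < S x,
      order_continuous S,
      forall x, S (S x) = S x,
      riesz_subspace (range S) /\ dedekind_complete (range S) &
      S e = e].

(* Sequences of conditional expectations and martingales are indexed from 0:
   [T 0] is the first conditional expectation. *)
Definition filtration (e : E) (T : nat -> {linear E -> E}) :=
  (forall i, conditional_expectation e (T i)) /\
  forall i j, (j <= i)%N ->
    forall x, T i (T j x) = T j x /\ T j (T i x) = T j x.

Definition laterally_complete :=
  forall D, D !=set0 -> (forall x, D x -> 0 <= x) ->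
    (forall x y, D x -> D y -> x <> y -> rdisjoint x y) ->
    supremums D !=set0.

End RieszSpaces.
Arguments laterally_complete {R} E.

Definition fsq {R : realType} {A : fAlgType R} (x : A) : A := fmul x x.

(* [iota] exhibits [Eu] as the universal completion of [E], and the
   multiplication of [Eu] is the one with unit [e]. *)
Definition universal_completion (R : realType) (E : rieszType R) (e : E)
    (Eu : fAlgType R) (iota : {linear E -> Eu}) :=
  [/\ dedekind_complete [set: Eu] /\ laterally_complete Eu,
      injective iota /\
        (forall x y, iota (rjoin x y) = rjoin (iota x) (iota y)),
      forall y : Eu, 0 < y -> exists2 x, 0 < iota x & iota x <= y &
      iota e = fone].

(* [sig] exhibits [Es] as the sup-completion of [E]. The last two fields are
   part of Donner's existence and uniqueness theorem; without them the other
   fields do not determine Es: for E = R^2 they also hold for E with a single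
   infinite element added, and for E = R for a cone with extra elements
   sup {x | x < a} lying strictly below a. *)
Record sup_completion (R : realType) (E : rieszType R)
    (Es : orderedConeType R) (sig : E -> Es) : Prop := {
  sup_completionD : forall x y, sig (x + y) = cadd (sig x) (sig y);
  sup_completionZ : forall (a : R) x, 0 <= a -> sig (a *: x) = cscale a (sig x);
  sup_completion_le : forall x y, (sig x <= sig y) = (x <= y);
  sup_completion_invertible : forall x : Es,
    range sig x <-> exists y, cadd x y = czero;
  sup_completion_top : exists t : Es, forall x, x <= t;
  sup_completion_complete : dedekind_complete [set: Es];
  sup_completion_approx : forall x : Es,
    [set g | sig g <= x] !=set0 /\
    supremums (sig @` [set g | sig g <= x]) x;
  sup_completion_solid : forall (x : Es) g, x <= sig g -> range sig x;
  sup_completion_meet : forall (A : set E) (s : Es) g, A !=set0 ->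
    supremums (sig @` A) s -> sig g <= s ->
    supremums [set sig (rmeet g a) | a in A] (sig g)
}.

Section Extensions.
Context {R : realType} {E : rieszType R} {Eu : fAlgType R}.
Context {Es : orderedConeType R}.
Variables (iota : {linear E -> Eu}) (sig : E -> Es).
Implicit Types (S : E -> E) (f : nat -> Eu).

(* Meant for x >= 0: the positive element x of Eu regarded as one of Es. *)
Definition u2s (x : Eu) : Es := supremum czero (sig @` [set g | iota g <= x]).

Definition s2u (x : Es) : Eu := xget 0 [set y | 0 <= y /\ u2s y = x].

Definition supS (x : nat -> Es) : Es := supremum czero (range x).

(* For x >= 0, {g in E | 0 <= g <= x} is an increasing net in the positive cone
   of E with supremum x. *)
Definition condS S (x : Es) : Es :=
  supremum czero [set sig (S g) | g in [set g | 0 <= g /\ sig g <= x]].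

(* The square of x >= 0 in Es, extended from the positive cone of E through the
   same net. *)
Definition sqS (x : Es) : Es :=
  supremum czero [set u2s (fsq (iota g)) | g in [set g | 0 <= g /\ sig g <= x]].

Definition L1 S : set Eu :=
  [set x | exists2 y, 0 <= y & condS S (u2s (rabs x)) = u2s y].

Definition condU S (x : Eu) : Eu :=
  s2u (condS S (u2s (rpos x))) - s2u (condS S (u2s (rneg x))).

(* T carries the natural domain, S is any conditional expectation extended
   to it. *)
Definition condU_range (T S : E -> E) : set Eu := condU S @` L1 T.

Definition sqrtU (x : Eu) : Eu := xget 0 [set y | 0 <= y /\ fsq y = x].

Definition L2 T : set Eu := [set x | L1 T x /\ L1 T (fsq (rabs x))].

Definition Loo T : set Eu :=
  [set x | L1 T x /\ exists2 r, condU_range T T r & rabs x <= r].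

Definition norm1 T (x : Eu) : Eu := condU T (rabs x).
Definition norm2 T (x : Eu) : Eu := sqrtU (condU T (fsq (rabs x))).
Definition normoo T (x : Eu) : Eu :=
  infimum 0 [set r | condU_range T T r /\ rabs x <= r].

Definition mnorm (N : Eu -> Eu) f : Es := supS (fun n => u2s (N (f n))).

Definition martingale (T : nat -> {linear E -> E}) f :=
  [/\ forall n, L1 (T 0%N) (f n),
      forall n, condU_range (T 0%N) (T n) (f n) &
      forall i j, (i <= j)%N -> condU (T i) (f j) = f i].

Definition mdiff f (n : nat) : Eu := if n is m.+1 then f n - f m else f 0%N.

Definition L1_bounded T f :=
  supremums_in (L1 T) (range (fun n => condU T (rabs (f n)))) !=set0.

Definition mdiff_max f : Es := supS (fun n => u2s (rabs (mdiff f n))).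

Definition absolutely_cvg_to T f (s : Eu) :=
  order_cvg_in (L1 T) (fun m n : nat => (m <= n)%N)
    (fun n => \sum_(k < n.+1) rabs (mdiff f k)) s.

Definition band_projS (x : Es) (g : E) : E :=
  band_proj (band_generated [set h | 0 <= h /\ sig h <= x]) g.

End Extensions.

(* Main.v *)
Require Import Defs.
From mathcomp Require Import all_boot all_order all_algebra.
From mathcomp Require Import boolp classical_sets reals.
From mathcomp Require Import ring lra.

Set Implicit Arguments.
Unset Strict Implicit.
Unset Printing Implicit Defensive.

Import Order.TTheory GRing.Theory Num.Theory.
Local Open Scope classical_set_scope.
Local Open Scope ring_scope.

(** Gundy's stopping time argument works with events and conditional
    expectations only, and both make sense in a Riesz space. Events are the
    components of the unit of the f-algebra [Eu]: multiplication by a component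
    is a band projection, and [posc x] is the event [x > 0].

    Let [t] be the first time at which [|f|] exceeds [lambda], and let [x] be the
    value of [f] at time [t]. Since [|f|] is a submartingale, optional stopping
    gives [T |x| <= ||f||] ([over_sum_le]). The predictable compensator of the
    increasing process [|x| 1_(t <= n)] has at most that expectation; let [s] be the
    last time before it exceeds [lambda]. The martingale [u] collects the
    increments of [f] after the minimum of [s] and [t]. Hence [f - u] is a stopped
    martingale, of norm at most [||f||] ([stopped_le]), and the increments of [u]
    live on an event on which the overshoot or the compensator is at least
    [lambda], so that Chebyshev's inequality bounds the expectation of that event
    ([runningC_le]). The martingale [v] is the compensated jump of [f] at time [t],
    stopped at [s]; the sum of its absolute increments is dominated by [|x|] and
    the compensator ([djump_sum_le]). What remains, [w], is the truncation of [f]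
    before time [t] plus a term dominated by the compensator up to time [s], so
    it is bounded by [2 lambda] ([bounded_part_le]); its norm is at most
    [||f - u|| + ||v||], and its square is at most [2 lambda |w|].

    The analytic part is to make conditional expectations act on the natural
    domain of [T]. For positive [x] in [Eu] the extension of an operator [S] is the
    supremum in [Eu] of the images of the elements of [E] below [x] ([ext]); the
    definition through the sup-completion has the same value ([condS_ext]). Order
    density of [E] and order continuity of [S] make the extension additive, order
    continuous and strictly positive, and they let it commute with the
    multiplication by measurable events ([condU_averaging]). The key fact is monotone
    convergence, [condU_bounded]: an upward directed set of positive elements with
    bounded conditional expectations is bounded in [Eu]. It is here that lateral
    completeness enters. It gives the existence of the absolute sum of the
    increments of [v], and it shows that the natural domain of [T] is contained in
    the natural domains of all the [T n] ([L1_filtration]). *)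

(** * Linear arithmetic in modules *)

Inductive lexp (R : Type) :=
  | LVar of nat | LZero | LAdd of lexp R & lexp R | LOpp of lexp R
  | LScale of R & lexp R.
Arguments LVar {R}.
Arguments LZero {R}.

Section LinearNormalisation.
Context {R : comNzRingType} {V : lmodType R}.

Fixpoint leval (env : seq V) (t : lexp R) : V :=
  match t with
  | LVar n => nth 0 env n
  | LZero => 0
  | LAdd a b => leval env a + leval env b
  | LOpp a => - leval env a
  | LScale c a => c *: leval env a
  end.

Fixpoint lcoef (t : lexp R) (i : nat) : R :=
  match t with
  | LVar n => if eqn n i then 1 else 0
  | LZero => 0
  | LAdd a b => lcoef a i + lcoef b i
  | LOpp a => - lcoef a i
  | LScale c a => c * lcoef a i
  end.

Fixpoint lsame (t1 t2 : lexp R) (n : nat) : Prop :=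
  if n is m.+1 then lcoef t1 m = lcoef t2 m /\ lsame t1 t2 m else True.

Lemma leval_coef env t :
  leval env t = \sum_(i < size env) lcoef t i *: env`_i.
Proof.
elim: t => [n||a IHa b IHb|a IHa|c a IHa] /=.
- case: (ltnP n (size env)) => [lt_n|le_n].
    rewrite (bigD1 (Ordinal lt_n)) //= -[eqn n n]/(n == n) eqxx scale1r.
    rewrite big1 ?addr0 // => i; rewrite -val_eqE /= eq_sym => ne_in.
    by rewrite -[eqn n i]/(n == i) (negbTE ne_in) scale0r.
  rewrite nth_default // big1 // => i _.
  rewrite -[eqn n i]/(n == i :> nat) gtn_eqF ?scale0r //.
  exact: leq_trans (ltn_ord i) le_n.
- by rewrite big1 // => i _; rewrite scale0r.
- by rewrite IHa IHb -big_split; apply: eq_bigr => i _; rewrite scalerDl.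
- by rewrite IHa -sumrN; apply: eq_bigr => i _; rewrite scaleNr.
- by rewrite IHa scaler_sumr; apply: eq_bigr => i _; rewrite scalerA.
Qed.

Lemma leval_eq env t1 t2 :
  lsame t1 t2 (size env) -> leval env t1 = leval env t2.
Proof.
rewrite !leval_coef; elim: (size env) => [|n IHn] /=; first by rewrite !big_ord0.
by move=> [eq_n /IHn]; rewrite !big_ord_recr /= eq_n => ->.
Qed.

End LinearNormalisation.

(* Atoms are compared up to conversion: the same element may be displayed
   through different paths of the structure hierarchy. The operations that
   head most atoms stay folded, which makes a failing comparison cheap. *)
Create HintDb lin_atoms.
#[export] Hint Opaque rabs rpos rneg condU : lin_atoms.

Ltac lin_index x env :=
  match env with
  | ?y :: _ => let _ := match goal with _ => unify x y with lin_atoms end in constr:(0%N)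
  | _ :: ?env' => let n := lin_index x env' in constr:(S n)
  end.

Ltac lin_mem x env :=
  match env with
  | ?y :: _ => let _ := match goal with _ => unify x y with lin_atoms end in constr:(true)
  | _ :: ?env' => lin_mem x env'
  | nil => constr:(false)
  end.

Ltac lin_atoms env t :=
  lazymatch t with
  | 0 => env
  | ?a + ?b => let env' := lin_atoms env a in lin_atoms env' b
  | - ?a => lin_atoms env a
  | _ *: ?a => lin_atoms env a
  | ?x => lazymatch lin_mem x env with
          | true => env
          | false => constr:(x :: env)
          end
  end.

Ltac lin_reify R env t :=
  lazymatch t with
  | 0 => constr:(@LZero R)
  | ?a + ?b => let a' := lin_reify R env a in
               let b' := lin_reify R env b in constr:(@LAdd R a' b')
  | - ?a => let a' := lin_reify R env a in constr:(@LOpp R a')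
  | ?c *: ?a => let a' := lin_reify R env a in constr:(@LScale R c a')
  | ?x => let n := lin_index x env in constr:(@LVar R n)
  end.

(** Proves an equation between linear combinations by comparing, for each
    atom, the two coefficients in the scalar ring [R]. *)
Ltac lin_over R :=
  lazymatch goal with
  | |- @eq ?V ?t1 ?t2 =>
    let env1 := lin_atoms (@nil V) t1 in
    let env := lin_atoms env1 t2 in
    let r1 := lin_reify R env t1 in
    let r2 := lin_reify R env t2 in
    refine (@leval_eq _ _ env r1 r2 _);
    cbn [lsame lcoef size eqn];
    repeat (apply: conj; [by ring | ]); exact: I
  end.

(** * Riesz spaces *)

Section RieszTheory.
Context {R : realType} {E : rieszType R}.
Implicit Types (x y z h s t : E) (A D : set E).

Local Ltac lin := lin_over R.

Lemma rle_subE x y x' y' : y' - x' = y - x -> (x <= y) = (x' <= y').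
Proof.
move=> e; apply/idP/idP.
- move=> /(@rler_wD2r R E (x' - x)).
  have -> : x + (x' - x) = x' by lin.
  suff -> : y + (x' - x) = y' by [].
  by rewrite -[y'](subrK x') e; lin.
- move=> /(@rler_wD2r R E (x - x')).
  have -> : x' + (x - x') = x by lin.
  suff -> : y' + (x - x') = y by [].
  by rewrite -[y](subrK x) -e; lin.
Qed.

(** Reduces [x' <= y'] to an equation between linear combinations: the
    inequality has to differ from [x <= y] by a translation. *)
Lemma rle_sub x y x' y' : x <= y -> y' - x' = y - x -> x' <= y'.
Proof. by move=> xy /rle_subE <-. Qed.

Lemma rleD x y x' y' : x <= y -> x' <= y' -> x + x' <= y + y'.
Proof.
move=> xy x'y'; apply: (@le_trans _ _ (y + x')); first exact: rler_wD2r.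
by apply: (rle_sub x'y'); lin.
Qed.

Lemma rscale_ge0 (a : R) x : 0 <= a -> 0 <= x -> 0 <= a *: x.
Proof. exact: rscaler_ge0. Qed.

Lemma rle_scale (a : R) x y : 0 <= a -> x <= y -> a *: x <= a *: y.
Proof.
move=> a0 xy; have xy0 : 0 <= y - x by apply: (rle_sub xy); lin.
by apply: (rle_sub (rscale_ge0 a0 xy0)); lin.
Qed.

Lemma rle_scaleV (a : R) x y : 0 < a -> (a *: x <= y) = (x <= a^-1 *: y).
Proof.
move=> a0; have e z : a^-1 *: (a *: z) = z by rewrite scalerA mulVf ?gt_eqF ?scale1r.
have e' z : a *: (a^-1 *: z) = z by rewrite scalerA mulfV ?gt_eqF ?scale1r.
apply/idP/idP => [h|h].
  by rewrite -(e x) rle_scale // invr_ge0 ltW.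
by rewrite -[leRHS]e' rle_scale // ltW.
Qed.

Lemma rle_scalel (a b : R) x : a <= b -> 0 <= x -> a *: x <= b *: x.
Proof.
by rewrite -subr_ge0 => ab x0; apply: (rle_sub (rscale_ge0 ab x0)); lin.
Qed.

Lemma raddr_ge0 x y : 0 <= x -> 0 <= y -> 0 <= x + y.
Proof. by move=> x0 y0; apply: (rle_sub (rleD x0 y0)); lin. Qed.

Lemma rjoinl x y : x <= rjoin x y.
Proof. by have := lexx (rjoin x y); rewrite rjoin_le => /andP[]. Qed.
Lemma rjoinr x y : y <= rjoin x y.
Proof. by have := lexx (rjoin x y); rewrite rjoin_le => /andP[]. Qed.
Lemma rmeetl x y : rmeet x y <= x.
Proof. by have := lexx (rmeet x y); rewrite rmeet_ge => /andP[]. Qed.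
Lemma rmeetr x y : rmeet x y <= y.
Proof. by have := lexx (rmeet x y); rewrite rmeet_ge => /andP[]. Qed.

Lemma rjoin_lub x y z : x <= z -> y <= z -> rjoin x y <= z.
Proof. by rewrite rjoin_le => -> ->. Qed.
Lemma rmeet_glb x y z : z <= x -> z <= y -> z <= rmeet x y.
Proof. by rewrite rmeet_ge => -> ->. Qed.

Lemma rjoinC x y : rjoin x y = rjoin y x.
Proof. by apply: le_anti; rewrite !rjoin_le !rjoinl !rjoinr. Qed.
Lemma rmeetC x y : rmeet x y = rmeet y x.
Proof. by apply: le_anti; rewrite !rmeet_ge !rmeetl !rmeetr. Qed.

Lemma rjoin_l x y : y <= x -> rjoin x y = x.
Proof. by move=> yx; apply: le_anti; rewrite rjoinl rjoin_lub. Qed.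
Lemma rmeet_l x y : x <= y -> rmeet x y = x.
Proof. by move=> xy; apply: le_anti; rewrite rmeetl rmeet_glb. Qed.

Lemma rmeet_mono x y x' y' : x <= x' -> y <= y' -> rmeet x y <= rmeet x' y'.
Proof.
move=> xx' yy'; apply: rmeet_glb.
- exact: le_trans (rmeetl _ _) xx'.
- exact: le_trans (rmeetr _ _) yy'.
Qed.

Lemma rmeet_ge0 x y : 0 <= x -> 0 <= y -> 0 <= rmeet x y.
Proof. exact: rmeet_glb. Qed.

Lemma rjoinD x y z : rjoin (x + z) (y + z) = rjoin x y + z.
Proof.
apply: le_anti; apply/andP; split.
- by apply: rjoin_lub; apply: rler_wD2r; [apply: rjoinl|apply: rjoinr].
- suff h : rjoin x y <= rjoin (x + z) (y + z) - z.
    by apply: (rle_sub h); lin.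
  apply: rjoin_lub; first by apply: (rle_sub (rjoinl (x + z) (y + z))); lin.
  by apply: (rle_sub (rjoinr (x + z) (y + z))); lin.
Qed.

Lemma rmeet_join x y : rmeet x y = x + y - rjoin x y.
Proof.
apply: le_anti; apply/andP; split.
- suff h : rjoin x y <= x + y - rmeet x y by apply: (rle_sub h); lin.
  apply: rjoin_lub; first by apply: (rle_sub (rmeetr x y)); lin.
  by apply: (rle_sub (rmeetl x y)); lin.
- apply: rmeet_glb; first by apply: (rle_sub (rjoinr x y)); lin.
  by apply: (rle_sub (rjoinl x y)); lin.
Qed.

Lemma rmeetD x y z : rmeet (x + z) (y + z) = rmeet x y + z.
Proof. by rewrite !rmeet_join rjoinD; lin. Qed.

Lemma rjoinZ (a : R) x y : 0 <= a -> rjoin (a *: x) (a *: y) = a *: rjoin x y.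
Proof.
rewrite le_eqVlt => /predU1P[<-|a0].
  by rewrite !scale0r rjoin_l.
apply: le_anti; apply/andP; split.
  by apply: rjoin_lub; apply: rle_scale (ltW a0) _; [apply: rjoinl|apply: rjoinr].
by rewrite rle_scaleV //; apply: rjoin_lub; rewrite -rle_scaleV // ?rjoinl ?rjoinr.
Qed.

Lemma rmeetZ (a : R) x y : 0 <= a -> rmeet (a *: x) (a *: y) = a *: rmeet x y.
Proof. by move=> a0; rewrite !rmeet_join rjoinZ //; lin. Qed.

(** ** Positive part, negative part and absolute value *)

Lemma rpos_ge0 x : 0 <= rpos x. Proof. exact: rjoinr. Qed.
Lemma rneg_ge0 x : 0 <= rneg x. Proof. exact: rjoinr. Qed.
Lemma le_rpos x : x <= rpos x. Proof. exact: rjoinl. Qed.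

Lemma rpos_le x y : x <= y -> 0 <= y -> rpos x <= y.
Proof. exact: rjoin_lub. Qed.

Lemma rpos_mono x y : x <= y -> rpos x <= rpos y.
Proof.
by move=> xy; apply: rpos_le (rpos_ge0 _); apply: le_trans xy (le_rpos _).
Qed.

Lemma rnegE x : rneg x = rpos x - x.
Proof.
rewrite /rneg /rpos; have -> : rjoin (- x) 0 = rjoin (0 - x) (x - x).
  by congr rjoin; lin.
by rewrite rjoinD rjoinC.
Qed.

Lemma rpos_neg x : x = rpos x - rneg x.
Proof. by rewrite rnegE; lin. Qed.

Lemma rpos_ge x : 0 <= x -> rpos x = x.
Proof. exact: rjoin_l. Qed.

Lemma rneg_ge x : 0 <= x -> rneg x = 0.
Proof. by move=> x0; rewrite rnegE rpos_ge // subrr. Qed.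

Lemma rpos0_le x : rpos x = 0 -> x <= 0.
Proof. by move=> <-; apply: le_rpos. Qed.

Lemma rmeet_pos_neg x : rmeet (rpos x) (rneg x) = 0.
Proof.
have -> : rpos x = x + rneg x by rewrite rnegE; lin.
rewrite -{2}[rneg x]add0r rmeetD rmeet_join.
have -> : rjoin x 0 = rpos x by [].
by rewrite rnegE; lin.
Qed.

Lemma rle_abs x : x <= rabs x. Proof. exact: rjoinl. Qed.
Lemma rleN_abs x : - x <= rabs x. Proof. exact: rjoinr. Qed.

Lemma rabs_le x y : (rabs x <= y) = (x <= y) && (- x <= y).
Proof. exact: rjoin_le. Qed.

Lemma rabs_lub x y : x <= y -> - x <= y -> rabs x <= y.
Proof. exact: rjoin_lub. Qed.

Lemma rabsN x : rabs (- x) = rabs x.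
Proof. by rewrite /rabs opprK rjoinC. Qed.

Lemma rabsE x : rabs x = rpos x + rneg x.
Proof.
rewrite rnegE /rabs /rpos.
have -> : rjoin x (- x) = rjoin (2 *: x - x) (0 - x) by congr rjoin; lin.
rewrite rjoinD -[X in rjoin _ X](scaler0 E (2 : R)) rjoinZ //.
by lin.
Qed.

Lemma rabs_ge0 x : 0 <= rabs x.
Proof. by rewrite rabsE raddr_ge0 ?rpos_ge0 ?rneg_ge0. Qed.

Lemma rabs_ge x : 0 <= x -> rabs x = x.
Proof. by move=> x0; rewrite rabsE rpos_ge // rneg_ge // addr0. Qed.

Lemma rabs_abs x : rabs (rabs x) = rabs x.
Proof. by rewrite rabs_ge ?rabs_ge0. Qed.

Lemma rabs0 : rabs (0 : E) = 0. Proof. by rewrite rabs_ge. Qed.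

Lemma rabs_eq0 x : rabs x <= 0 -> x = 0.
Proof.
rewrite rabs_le => /andP[x0 nx0]; apply: le_anti; rewrite x0 /=.
by apply: (rle_sub nx0); lin.
Qed.

Lemma rabsD x y : rabs (x + y) <= rabs x + rabs y.
Proof.
apply: rabs_lub; first exact: rleD (rle_abs _) (rle_abs _).
by rewrite opprD; apply: rleD (rleN_abs _) (rleN_abs _).
Qed.

Lemma rabsB x y : rabs (x - y) <= rabs x + rabs y.
Proof. by rewrite -[rabs y]rabsN; apply: rabsD. Qed.

Lemma rabsZ (a : R) x : 0 <= a -> rabs (a *: x) = a *: rabs x.
Proof. by move=> a0; rewrite /rabs -rjoinZ // scalerN. Qed.

Lemma rpos_le_abs x : rpos x <= rabs x.
Proof. by apply: rpos_le (rabs_ge0 _); apply: rle_abs. Qed.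

Lemma rneg_le_abs x : rneg x <= rabs x.
Proof. by rewrite -rabsN; apply: rpos_le_abs. Qed.

Lemma rjoin_rpos x y : rjoin x y = y + rpos (x - y).
Proof.
rewrite /rpos; have -> : rjoin (x - y) 0 = rjoin (x - y) (y - y).
  by congr rjoin; lin.
by rewrite rjoinD; lin.
Qed.

Lemma rmeet_rpos x y : rmeet x y = x - rpos (x - y).
Proof. by rewrite rmeet_join rjoin_rpos; lin. Qed.

(** ** Disjointness of positive elements *)

(** If [h] is the meet on the left, then [h - rmeet x y] is the join of [h - x]
    and [h - y], and both of these are below [x] and below [z]. *)
Lemma rmeetDr_le x y z : 0 <= x -> 0 <= y -> 0 <= z ->
  rmeet x (y + z) <= rmeet x y + rmeet x z.
Proof.
move=> x0 y0 z0; set h := rmeet x (y + z).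
have hx : h <= x by apply: rmeetl.
have hyz : h <= y + z by apply: rmeetr.
suff k : h - rmeet x y <= rmeet x z by apply: (rle_sub k); lin.
have -> : h - rmeet x y = rjoin (y + (h - x - y)) (x + (h - x - y)).
  by rewrite rjoinD rjoinC rmeet_join; lin.
apply: rjoin_lub; apply: rmeet_glb.
- by apply: (rle_sub (rleD hx x0)); lin.
- by apply: (rle_sub (rleD hx z0)); lin.
- by apply: (rle_sub (rleD hx y0)); lin.
- by apply: (rle_sub hyz); lin.
Qed.

Lemma disjointD x y z : 0 <= x -> 0 <= y -> 0 <= z ->
  rmeet x y = 0 -> rmeet x z = 0 -> rmeet x (y + z) = 0.
Proof.
move=> x0 y0 z0 xy xz; apply: le_anti; apply/andP; split.
  by have := rmeetDr_le x0 y0 z0; rewrite xy xz addr0.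
by rewrite rmeet_ge0 // raddr_ge0.
Qed.

Lemma disjoint_le x y x' y' : 0 <= x' -> 0 <= y' -> x' <= x -> y' <= y ->
  rmeet x y = 0 -> rmeet x' y' = 0.
Proof.
move=> x'0 y'0 xx' yy' xy; apply: le_anti; rewrite rmeet_ge0 // andbT.
by rewrite -xy rmeet_mono.
Qed.

Lemma disjoint_add_join x y : rmeet x y = 0 -> x + y = rjoin x y.
Proof. by rewrite rmeet_join => h; rewrite -[RHS]addr0 -h; lin. Qed.

Lemma disjoint_add_le x y z : rmeet x y = 0 -> x <= z -> y <= z -> x + y <= z.
Proof. by move=> /disjoint_add_join -> xz yz; apply: rjoin_lub. Qed.

Lemma disjoint_self x : rmeet x x = 0 -> x = 0.
Proof. by rewrite rmeet_l. Qed.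

(** The positive and the negative part are the only decomposition into a
    difference of disjoint positive elements. *)
Lemma rpos_disjoint x y : rmeet x y = 0 -> rpos (x - y) = x.
Proof. by rewrite rmeet_rpos => h; rewrite -[LHS]add0r -h; lin. Qed.

(** ** Suprema *)

Lemma supremums_unique D s t : supremums D s -> supremums D t -> s = t.
Proof.
by move=> [us ls] [ut lt]; apply: le_anti; rewrite (ls _ ut) (lt _ us).
Qed.

(** The identity [rmeet x a = x + a - rjoin x a] turns an upper bound of the
    meets into an upper bound of the elements [a]. *)
Lemma supremums_meet A s x :
  supremums A s -> supremums [set rmeet x a | a in A] (rmeet x s).
Proof.
move=> [us ls]; split=> [_ [a Aa <-]|z uz].
  by apply: rmeet_mono => //; apply: us.
suff k : s <= z - x + rjoin x s by rewrite rmeet_join; apply: (rle_sub k); lin.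
apply: ls => a Aa.
have h1 : rmeet x a <= z by apply: uz; exists a.
have h2 : rjoin x a <= rjoin x s.
  by apply: rjoin_lub (rjoinl _ _) _; apply: le_trans (us _ Aa) (rjoinr _ _).
by apply: (rle_sub (rleD h1 h2)); rewrite rmeet_join; lin.
Qed.

Lemma disjoint_supremums A s x : 0 <= s -> 0 <= x -> supremums A s ->
  (forall a, A a -> rmeet x a <= 0) -> rmeet x s = 0.
Proof.
move=> s0 x0 /(supremums_meet x) [_ ls] h.
apply: le_anti; rewrite rmeet_ge0 // andbT.
by apply: ls => _ [a Aa <-]; apply: h.
Qed.

Definition upward (D : set E) :=
  forall x y, D x -> D y -> exists2 z, D z & x <= z /\ y <= z.

Lemma nondecreasing_le (x : nat -> E) i j :
  (forall n, x n <= x n.+1) -> (i <= j)%N -> x i <= x j.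
Proof.
by move=> xS /subnK <-; elim: (j - i)%N => // k ih; apply: le_trans ih (xS _).
Qed.

Lemma upward_nondecreasing (x : nat -> E) :
  (forall n, x n <= x n.+1) -> upward (range x).
Proof.
move=> xS _ _ [i _ <-] [j _ <-].
exists (x (maxn i j)); first by exists (maxn i j).
by rewrite !(nondecreasing_le xS) ?leq_maxl ?leq_maxr.
Qed.

End RieszTheory.

(* The standing hypotheses are classes, so that lemmas find them in the context. *)
Existing Class dedekind_complete.

Section DedekindComplete.
Context {R : realType} {E : rieszType R} {dcE : dedekind_complete [set: E]}.
Implicit Types (x y s b : E) (D : set E).

Local Ltac lin := lin_over R.

Lemma supremum_exists D b : D !=set0 -> ubound D b -> exists s, supremums D s.
Proof.
move=> D0 ub; have [|s [_ [us ls]]] := dcE (@subsetT _ D) D0.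
  by exists b.
by exists s; split=> // t ut; apply: ls.
Qed.

Lemma archimedean_le x y : (forall k : nat, k%:R *: x <= y) -> x <= 0.
Proof.
move=> h; have [|_ [k _ <-]|s [us ls]] :=
  @supremum_exists (range (fun k : nat => k%:R *: x)) y; first by exists (0%:R *: x), 0%N.
  exact: h.
suff sx : s <= s - x by apply: (rle_sub sx); lin.
apply: ls => _ [k _ <-].
have /us kx : range (fun k : nat => k%:R *: x) (k.+1%:R *: x) by exists k.+1.
by apply: (rle_sub kx); lin.
Qed.

End DedekindComplete.

(** * Components of the unit of an f-algebra *)

Reserved Notation "x ** y" (at level 40, left associativity).
Local Notation "x ** y" := (fmul x y).

Section FAlgebraTheory.
Context {R : realType} {A : fAlgType R}.
Implicit Types (x y z h p q s t : A) (D : set A).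

Local Ltac lin := lin_over R.

Lemma fmulDlr x y z : (x + y) ** z = x ** z + y ** z.
Proof. by have := fmulDl 1 x y z; rewrite !scale1r. Qed.
Lemma fmulDrr x y z : z ** (x + y) = z ** x + z ** y.
Proof. by have := fmulDr 1 x y z; rewrite !scale1r. Qed.
Lemma fmul0l x : 0 ** x = 0.
Proof. by apply: (addrI (0 ** x)); rewrite -fmulDlr !addr0. Qed.
Lemma fmul0r x : x ** 0 = 0.
Proof. by apply: (addrI (x ** 0)); rewrite -fmulDrr !addr0. Qed.
Lemma fmulZl (a : R) x z : (a *: x) ** z = a *: (x ** z).
Proof. by have := fmulDl a x 0 z; rewrite !addr0 fmul0l addr0. Qed.
Lemma fmulZr (a : R) x z : z ** (a *: x) = a *: (z ** x).
Proof. by have := fmulDr a x 0 z; rewrite !addr0 fmul0r addr0. Qed.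
Lemma fmulNl x z : (- x) ** z = - (x ** z).
Proof. by rewrite -scaleN1r fmulZl scaleN1r. Qed.
Lemma fmulNr x z : z ** (- x) = - (z ** x).
Proof. by rewrite -scaleN1r fmulZr scaleN1r. Qed.

Definition fmulE :=
  (fmulDlr, fmulDrr, fmulNl, fmulNr, fmulZl, fmulZr, fmul0l, fmul0r,
   @fmul1l R A, @fmul1r R A).

Lemma fmul_ge x y : 0 <= x -> 0 <= y -> 0 <= x ** y.
Proof. exact: fmul_ge0. Qed.

Lemma fmul_monor x y z : 0 <= z -> x <= y -> z ** x <= z ** y.
Proof.
move=> z0 xy; have xy0 : 0 <= y - x by apply: (rle_sub xy); lin.
by apply: (rle_sub (fmul_ge z0 xy0)); rewrite !fmulE; lin.
Qed.

Lemma fmul_monol x y z : 0 <= z -> x <= y -> x ** z <= y ** z.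
Proof.
move=> z0 xy; have xy0 : 0 <= y - x by apply: (rle_sub xy); lin.
by apply: (rle_sub (fmul_ge xy0 z0)); rewrite !fmulE; lin.
Qed.

Lemma fmul_disjoint x y : rmeet x y = 0 -> x ** y = 0.
Proof.
move=> xy; have x0 : 0 <= x by rewrite -xy rmeetl.
have y0 : 0 <= y by rewrite -xy rmeetr.
apply: disjoint_self; apply: fmulr_disjoint => //.
by rewrite rmeetC; apply: fmull_disjoint => //; rewrite rmeetC.
Qed.

(** The positive part of the unit annihilates the negative part [n], so that
    [n = fone ** n = - (n ** n)] is negative. *)
Lemma fone_ge0 : 0 <= fone :> A.
Proof.
have n0 := rneg_ge0 (fone : A).
have e : rneg (fone : A) = - (rneg (fone : A) ** rneg (fone : A)).
  rewrite -[LHS]fmul1l {1}(rpos_neg fone) fmulDlr fmulNl.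
  by rewrite (fmul_disjoint (rmeet_pos_neg _)) add0r.
have z : rneg (fone : A) = 0.
  apply: le_anti; rewrite n0 andbT e.
  by apply: (rle_sub (fmul_ge n0 n0)); lin.
by have := rpos_ge0 (fone : A); have := rnegE (fone : A); rewrite z => /eqP;
  rewrite eq_sym subr_eq0 => /eqP ->.
Qed.

Lemma weak_unit x : rmeet x fone = 0 -> x = 0.
Proof. by move/fmul_disjoint; rewrite fmul1r. Qed.

Definition is_comp p := rmeet p (fone - p) = 0.

Lemma comp_ge0 p : is_comp p -> 0 <= p.
Proof. by move=> <-; apply: rmeetl. Qed.

Lemma compC p : is_comp p -> is_comp (fone - p).
Proof.
by rewrite /is_comp rmeetC; have -> : fone - (fone - p) = p by lin.
Qed.

Lemma comp_le1 p : is_comp p -> p <= fone.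
Proof. by move=> /compC /comp_ge0 h; apply: (rle_sub h); lin. Qed.

Lemma comp0 : is_comp 0.
Proof. by rewrite /is_comp rmeet_l // subr0 fone_ge0. Qed.

Lemma comp1 : is_comp fone.
Proof. by have := compC comp0; rewrite subr0. Qed.

Lemma comp_fmul_disjoint p x : is_comp p -> 0 <= x -> rmeet (p ** x) (fone - p) = 0.
Proof. exact: fmulr_disjoint. Qed.

Lemma fmul_comp_disjoint p x : is_comp p -> 0 <= x -> rmeet (x ** p) (fone - p) = 0.
Proof. exact: fmull_disjoint. Qed.

Lemma comp_mulC0 p x : is_comp p -> 0 <= x -> p ** ((fone - p) ** x) = 0.
Proof.
move=> cp x0; rewrite fmulA; have -> : p ** (fone - p) = 0.
  exact: fmul_disjoint.
by rewrite fmul0l.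
Qed.

Lemma comp_idem p : is_comp p -> p ** p = p.
Proof.
move=> /fmul_disjoint; rewrite !fmulE => h.
by rewrite -[LHS]addr0 -h; lin.
Qed.

(** Both [p ** x] and [x ** p] lie in the band of [p]; hence both are equal to
    [p ** x ** p]. *)
Lemma comp_comm p x : is_comp p -> p ** x = x ** p.
Proof.
move=> cp; wlog x0 : x / 0 <= x.
  move=> wh; rewrite (rpos_neg x) !fmulE.
  by rewrite (wh _ (rpos_ge0 x)) (wh _ (rneg_ge0 x)).
have h1 := fmul_disjoint (comp_fmul_disjoint cp x0).
have := fmul_comp_disjoint cp x0; rewrite rmeetC => /fmul_disjoint h2.
have e1 : p ** x ** p = p ** x.
  by move: h1; rewrite !fmulE => h1; rewrite -[LHS]addr0 -h1; lin.
have e2 : p ** (x ** p) = x ** p.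
  by move: h2; rewrite !fmulE => h2; rewrite -[LHS]addr0 -h2; lin.
by rewrite -e1 -e2 fmulA.
Qed.

Lemma comp_mul_le p x : is_comp p -> 0 <= x -> p ** x <= x.
Proof.
by move=> cp x0; have := fmul_monol x0 (comp_le1 cp); rewrite fmul1l.
Qed.

Lemma comp_mul_ge0 p x : is_comp p -> 0 <= x -> 0 <= p ** x.
Proof. by move=> /comp_ge0; apply: fmul_ge. Qed.

Lemma comp_mono p x y : is_comp p -> x <= y -> p ** x <= p ** y.
Proof. by move=> /comp_ge0; apply: fmul_monor. Qed.

(** [p ** x = x] expresses that [x] lies in the band generated by [p]. *)
Lemma comp_fixP p x : is_comp p -> 0 <= x ->
  p ** x = x <-> rmeet x (fone - p) = 0.
Proof.
move=> cp x0; split=> [<-|]; first exact: comp_fmul_disjoint.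
move=> /fmul_disjoint; rewrite -comp_comm; last exact: compC.
by rewrite !fmulE => h; rewrite -[LHS]addr0 -h; lin.
Qed.

Lemma comp_fix_le p x y : is_comp p -> 0 <= x -> x <= y -> p ** y = y -> p ** x = x.
Proof.
move=> cp x0 xy; have y0 := le_trans x0 xy.
move=> /(comp_fixP cp y0) h; apply/(comp_fixP cp x0).
by apply: disjoint_le h => //; apply: comp_ge0; apply: compC.
Qed.

Lemma comp_mul p q : is_comp p -> is_comp q -> is_comp (p ** q).
Proof.
move=> cp cq; have p0 := comp_ge0 cp; have q0 := comp_ge0 cq.
rewrite /is_comp; have -> : fone - p ** q = (fone - p) + p ** (fone - q) :> A.
  by rewrite !fmulE; lin.
have c0 := comp_ge0 (compC cp); have c1 := comp_ge0 (compC cq).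
apply: disjointD; rewrite ?fmul_ge //; first exact: comp_fmul_disjoint.
rewrite rmeetC; apply: (disjoint_le (x := fone - q) (y := p ** q)) => //.
- exact: fmul_ge.
- exact: fmul_ge.
- exact: comp_mul_le.
- by rewrite rmeetC; apply: fmull_disjoint.
Qed.

Lemma comp_le_mul p q : is_comp p -> is_comp q -> p <= q -> q ** p = p.
Proof.
by move=> cp cq pq; apply: comp_fix_le (comp_ge0 cp) pq _ => //; apply: comp_idem.
Qed.

Lemma compB p q : is_comp p -> is_comp q -> p <= q -> is_comp (q - p).
Proof.
move=> cp cq /(comp_le_mul cp cq) h.
have -> : q - p = q ** (fone - p) by rewrite !fmulE h; lin.
by apply: comp_mul => //; apply: compC.
Qed.

Lemma comp_rpos p x : is_comp p -> rpos (p ** x) = p ** rpos x.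
Proof.
move=> cp; rewrite [in LHS](rpos_neg x) !fmulE; apply: rpos_disjoint.
apply: disjoint_le (rmeet_pos_neg x); rewrite ?comp_mul_ge0 //.
- exact: rpos_ge0.
- exact: rneg_ge0.
- exact/comp_mul_le/rpos_ge0.
- exact/comp_mul_le/rneg_ge0.
Qed.

Lemma comp_abs p x : is_comp p -> rabs (p ** x) = p ** rabs x.
Proof.
by move=> cp; rewrite !rabsE !rnegE comp_rpos // !fmulE; lin.
Qed.

(** The counterpart of a proof by cases: does the event [p] occur or not? *)
Lemma comp_split_le p x y : is_comp p -> p ** x <= p ** y ->
  (fone - p) ** x <= (fone - p) ** y -> x <= y.
Proof.
by move=> cp h1 h2; apply: (rle_sub (rleD h1 h2)); rewrite !fmulE; lin.
Qed.

Lemma comp_mul_supremums p D s : is_comp p ->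
  supremums D s -> supremums [set p ** d | d in D] (p ** s).
Proof.
move=> cp [us ls]; split=> [_ [d Dd <-]|z uz].
  by apply: comp_mono => //; apply: us.
suff h : s <= z + (fone - p) ** s by apply: (rle_sub h); rewrite !fmulE; lin.
apply: ls => d Dd.
have h1 : p ** d <= z by apply: uz; exists d.
have h2 := comp_mono (compC cp) (us _ Dd).
by apply: (rle_sub (rleD h1 h2)); rewrite !fmulE; lin.
Qed.

Lemma comp_supremums D s : D !=set0 -> (forall p, D p -> is_comp p) ->
  supremums D s -> is_comp s.
Proof.
move=> [p0 Dp0] cD sD; have [us ls] := sD.
have s0 : 0 <= s by apply: le_trans (comp_ge0 (cD _ Dp0)) (us _ Dp0).
have s1 : 0 <= fone - s.
  have h : s <= fone by apply: ls => p /cD /comp_le1.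
  by apply: (rle_sub h); lin.
rewrite /is_comp rmeetC; apply: disjoint_supremums sD _ => // p Dp.
rewrite -(cD _ Dp) rmeetC; apply: rmeet_mono => //.
by apply: (rle_sub (us _ Dp)); lin.
Qed.

Context {dcA : dedekind_complete [set: A]}.

(** Truncating [h] at the unit brings it below the [p k] themselves, and only
    0 is disjoint from the unit. *)
Lemma comp_mul_inf0 (p : nat -> A) x h : (forall k, is_comp (p k)) -> 0 <= x ->
  0 <= h -> (forall k, h <= p k ** x) ->
  (forall z, (forall k, z <= p k) -> z <= 0) -> h = 0.
Proof.
move=> cp x0 h0 hx pinf; apply: weak_unit; apply: le_anti.
rewrite rmeet_ge0 ?fone_ge0 // andbT; apply: pinf => k.
have m0 : 0 <= rmeet h fone by rewrite rmeet_ge0 ?fone_ge0.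
have <- : p k ** rmeet h fone = rmeet h fone.
  apply: (comp_fix_le (cp k) m0 (le_trans (rmeetl _ _) (hx k))).
  by rewrite fmulA comp_idem.
by rewrite -[leRHS]fmul1r; apply: comp_mono => //; apply: rmeetr.
Qed.

(** The component of the unit in the band generated by the positive part of
    [x], that is, the indicator of the event [x > 0]. *)
Definition posc x : A :=
  supremum 0 (range (fun k : nat => rmeet (k%:R *: rpos x) fone)).

Lemma supremumP D x0 b : D !=set0 -> ubound D b -> supremums D (supremum x0 D).
Proof.
move=> D0 ub; rewrite /supremum; case: ifPn => [/eqP D00|_].
  by move: D0; rewrite D00 => -[].
by apply: xgetPex; apply: (supremum_exists D0 ub).
Qed.

Lemma poscP x :
  supremums (range (fun k : nat => rmeet (k%:R *: rpos x) fone)) (posc x).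
Proof.
apply: (@supremumP _ _ fone); first by exists (rmeet (0%:R *: rpos x) fone), 0%N.
by move=> _ [k _ <-]; apply: rmeetr.
Qed.

Lemma posc_ge k x : rmeet (k%:R *: rpos x) fone <= posc x.
Proof. by have [us _] := poscP x; apply: us; exists k. Qed.

Lemma posc_le1 x : posc x <= fone.
Proof. by have [_ ls] := poscP x; apply: ls => _ [k _ <-]; apply: rmeetr. Qed.

Lemma posc_ge0 x : 0 <= posc x.
Proof.
by apply: le_trans (posc_ge 0 x); rewrite scale0r rmeet_ge0 ?fone_ge0.
Qed.

(** [2 c] and the unit meet in [c], because the truncations that define [c]
    are stable under doubling; this says that [c] is a component. *)
Lemma posc_comp x : is_comp (posc x).
Proof.
set c := posc x; have c0 : 0 <= c by apply: posc_ge0.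
have c10 : 0 <= fone - c by apply: (rle_sub (posc_le1 x)); lin.
apply: le_anti; rewrite rmeet_ge0 // andbT.
suff h : rmeet (2 *: c) fone <= c.
  apply: (rle_sub h); have -> : rmeet c (fone - c) = rmeet (2 *: c) fone - c.
    by rewrite -rmeetD; congr rmeet; lin.
  by lin.
have [_ ls] := poscP x.
rewrite rmeetC; have h2 : supremums
   (range (fun k : nat => 2 *: rmeet (k%:R *: rpos x) fone)) (2 *: c).
  split=> [_ [k _ <-]|t ut]; first by apply: rle_scale => //; apply: posc_ge.
  rewrite rle_scaleV //; apply: ls => _ [k _ <-].
  by rewrite -rle_scaleV //; apply: ut; exists k.
have [_ lm] := supremums_meet fone h2; apply: lm => _ [_ [k _ <-] <-].
apply: le_trans (posc_ge (k * 2) x); rewrite -rmeetZ //.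
apply: rmeet_glb; last exact: rmeetl.
apply: le_trans (rmeetr _ _) _; apply: le_trans (rmeetl _ _) _.
by rewrite scalerA natrM mulrC.
Qed.

(** The meet [h] of [rpos x] and [fone - posc x] vanishes because all its
    multiples stay below [posc x]: adding [h] to an element below [posc x]
    gives an element below the unit. *)
Lemma posc_pos x : posc x ** rpos x = rpos x.
Proof.
set c := posc x; have cc : is_comp c by apply: posc_comp.
apply/(comp_fixP cc (rpos_ge0 x)); set h := rmeet _ _.
have h0 : 0 <= h by rewrite rmeet_ge0 ?rpos_ge0 ?comp_ge0 //; apply: compC.
have hx : h <= rpos x by apply: rmeetl.
have hc : h <= fone - c by apply: rmeetr.
apply: le_anti; rewrite h0 andbT; apply: (archimedean_le (y := fone)) => k.
apply: le_trans (comp_le1 cc); elim: k => [|k IHk].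
  by rewrite scale0r comp_ge0.
apply: le_trans (posc_ge k.+1 x); apply: rmeet_glb.
  by apply: rle_scale.
by apply: (rle_sub (rleD IHk hc)); lin.
Qed.

Lemma posc_disjoint x y : 0 <= y -> rmeet (rpos x) y = 0 -> posc x ** y = 0.
Proof.
move=> y0 xy; rewrite comp_comm; last exact: posc_comp.
apply: fmul_disjoint; apply: disjoint_supremums (poscP x) _ => //.
  exact: posc_ge0.
move=> _ [k _ <-]; apply: (@le_trans _ _ (rmeet y (k%:R *: rpos x))).
  by apply: rmeet_mono => //; apply: rmeetl.
have kx0 (n : nat) : 0 <= n%:R *: rpos x by rewrite rscale_ge0 ?rpos_ge0.
elim: k => [|k IHk]; first by rewrite scale0r rmeetr.
have -> : k.+1%:R *: rpos x = k%:R *: rpos x + rpos x by lin.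
rewrite disjointD // ?rpos_ge0 //; last by rewrite rmeetC.
by apply: le_anti; rewrite IHk rmeet_ge0.
Qed.

Lemma posc_mul x : posc x ** x = rpos x.
Proof.
rewrite [in X in _ ** X](rpos_neg x) fmulDrr posc_pos fmulNr.
by rewrite posc_disjoint ?subr0 ?rneg_ge0 ?rmeet_pos_neg.
Qed.

Lemma posc_mul_ge0 x : 0 <= posc x ** x.
Proof. by rewrite posc_mul rpos_ge0. Qed.

Lemma poscC_mul_le0 x : (fone - posc x) ** x <= 0.
Proof.
rewrite fmulDlr fmul1l fmulNl posc_mul; apply: (rle_sub (le_rpos x)); lin.
Qed.

Lemma posc_mono x y : x <= y -> posc x <= posc y.
Proof.
move=> xy; have [_ ls] := poscP x; apply: ls => _ [k _ <-].
apply: le_trans (posc_ge k y); apply: rmeet_mono => //.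
by apply: rle_scale => //; apply: rpos_mono.
Qed.

Lemma posc_chebyshev (a : R) x : 0 <= x -> a *: posc (x - a *: fone) <= x.
Proof.
move=> x0; have cc := posc_comp (x - a *: fone).
apply: le_trans (comp_mul_le cc x0).
by apply: (rle_sub (posc_mul_ge0 (x - a *: fone))); rewrite !fmulE; lin.
Qed.

Lemma poscC_le (a : R) x :
  (fone - posc (x - a *: fone)) ** x <= a *: (fone - posc (x - a *: fone)).
Proof.
by apply: (rle_sub (poscC_mul_le0 (x - a *: fone))); rewrite !fmulE; lin.
Qed.

(** What the truncation at [k] leaves over lives on the event [x > k], and by
    Chebyshev's inequality these events shrink to 0. *)
Lemma supremums_trunc x : 0 <= x ->
  supremums (range (fun k : nat => rmeet x (k%:R *: fone))) x.
Proof.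
move=> x0; split=> [_ [k _ <-]|t ut]; first exact: rmeetl.
have ut' k : rmeet x (k%:R *: fone) <= t by apply: ut; exists k.
suff h : rpos (x - t) = 0 by apply: (rle_sub (rpos0_le h)); lin.
apply: (@comp_mul_inf0 (fun k => posc (x - k%:R *: fone)) x) => //.
- by move=> k; apply: posc_comp.
- exact: rpos_ge0.
- move=> k; apply: (@le_trans _ _ (rpos (x - k%:R *: fone))).
    apply: rpos_le (rpos_ge0 _); have := ut' k; rewrite rmeet_rpos => h.
    by apply: (rle_sub h); lin.
  rewrite -posc_mul; apply: comp_mono; first exact: posc_comp.
  have k0 : 0 <= k%:R *: fone :> A by rewrite rscale_ge0 ?fone_ge0.
  by apply: (rle_sub k0); lin.
- move=> z zp; apply: (archimedean_le (y := x)) => k.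
  by apply: le_trans (posc_chebyshev k%:R x0); apply: rle_scale.
Qed.

(** ** Squares *)

(** On the event [x > y] the product is below the first square, elsewhere it
    is below the second one. *)
Lemma fmul_le_sq x y z : 0 <= x -> 0 <= y -> x ** x <= z -> y ** y <= z ->
  x ** y <= z.
Proof.
move=> x0 y0 xz yz; set c := posc (x - y); have cc : is_comp c by apply: posc_comp.
have c'c := compC cc.
apply: (comp_split_le cc).
- apply: le_trans (comp_mono cc xz).
  rewrite !fmulA (comp_comm x cc) -!fmulA; apply: fmul_monor => //.
  by apply: (rle_sub (posc_mul_ge0 (x - y))); rewrite !fmulE; lin.
- apply: le_trans (comp_mono c'c yz); rewrite !fmulA; apply: fmul_monol => //.
  by apply: (rle_sub (poscC_mul_le0 (x - y))); rewrite !fmulE; lin.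
Qed.

(** Products of two members of [D] are below [z] too, and one may pass to the
    supremum in each factor because multiplication by a bounded element is
    order continuous. *)
Lemma sq_supremums_le D (a : R) s z : 0 < a -> D !=set0 ->
  (forall d, D d -> [/\ 0 <= d, d <= a *: fone & d ** d <= z]) ->
  supremums D s -> s ** s <= z.
Proof.
move=> a0 [d0 Dd0] hD [us ls].
have s0 : 0 <= s by have [h _ _] := hD _ Dd0; apply: le_trans h (us _ Dd0).
have sa : s <= a *: fone by apply: ls => d /hD [].
have key (x w : A) : (forall d, D d -> x <= w - a *: d) -> x + a *: s <= w.
  move=> h; suff k : a *: s <= w - x by apply: (rle_sub k); lin.
  rewrite rle_scaleV //; apply: ls => d Dd; rewrite -rle_scaleV //.
  by apply: (rle_sub (h d Dd)); lin.
have sd d : D d -> s ** d <= z.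
  move=> Dd; have [dge da dz] := hD _ Dd.
  suff h : s ** d + a *: s <= z + a *: s by apply: (rle_sub h); lin.
  apply: key => d' Dd'; have [d'0 d'a d'z] := hD _ Dd'.
  have sd'0 : 0 <= s - d' by apply: (rle_sub (us _ Dd')); lin.
  have h1 := fmul_monor sd'0 da.
  have h2 := fmul_le_sq d'0 dge d'z dz.
  by apply: (rle_sub (rleD h1 h2)); rewrite !fmulE; lin.
suff h : s ** s + a *: s <= z + a *: s by apply: (rle_sub h); lin.
apply: key => d Dd; have [dge da dz] := hD _ Dd.
have sd0 : 0 <= s - d by apply: (rle_sub (us _ Dd)); lin.
have h1 := fmul_monol sd0 sa.
by apply: (rle_sub (rleD h1 (sd _ Dd))); rewrite !fmulE; lin.
Qed.

End FAlgebraTheory.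

(** * The universal completion *)

Existing Class universal_completion.
Existing Class sup_completion.
Existing Class conditional_expectation.

Section UniversalCompletion.
Context {R : realType} {E : rieszType R} {e : E} {Eu : fAlgType R}.
Context {iota : {linear E -> Eu}}.
Context {dcE : dedekind_complete [set: E]}
  {ucE : universal_completion e iota}.
Implicit Types (g h : E) (x y z s t : Eu).

Local Ltac lin := lin_over R.

#[export] Instance dcU : dedekind_complete [set: Eu].
Proof. by have [[]] := ucE. Qed.
Lemma latU : laterally_complete Eu. Proof. by have [[]] := ucE. Qed.
Lemma iota_inj : injective iota. Proof. by have [_ []] := ucE. Qed.
Lemma iota_join g h : iota (rjoin g h) = rjoin (iota g) (iota h).
Proof. by have [_ []] := ucE. Qed.
Lemma iota_dense x : 0 < x -> exists2 g, 0 < iota g & iota g <= x.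
Proof. by have [_ _ d _] := ucE; apply: d. Qed.
Lemma iota_e : iota e = fone. Proof. by have [] := ucE. Qed.

Lemma iota_le g h : (iota g <= iota h) = (g <= h).
Proof.
apply/idP/idP => gh.
  have : iota (rjoin h g) = iota h by rewrite iota_join rjoin_l.
  by move/iota_inj <-; apply: rjoinr.
by rewrite -(rjoin_l gh) iota_join rjoinr.
Qed.

Lemma iota_ge0 g : (0 <= iota g) = (0 <= g).
Proof. by rewrite -(linear0 iota) iota_le. Qed.

Lemma iota_gt0 g : (0 < iota g) = (0 < g).
Proof. by rewrite !lt_neqAle iota_ge0 -(linear0 iota) (inj_eq iota_inj). Qed.

Lemma iota_meet g h : iota (rmeet g h) = rmeet (iota g) (iota h).
Proof. by rewrite !rmeet_join linearB linearD iota_join. Qed.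

Lemma iota_abs g : iota (rabs g) = rabs (iota g).
Proof. by rewrite /rabs iota_join linearN. Qed.

(** A smaller upper bound in [Eu] would leave room for a positive element of
    [E], by order density. *)
Lemma iota_supremums (D : set E) g :
  supremums D g -> supremums (iota @` D) (iota g).
Proof.
move=> [ug lg]; split=> [_ [h Dh <-]|t ut]; first by rewrite iota_le ug.
suff p0 : rpos (iota g - t) = 0 by apply: (rle_sub (rpos0_le p0)); lin.
apply: contrapT => /eqP pn0; have : 0 < rpos (iota g - t).
  by rewrite lt_neqAle rpos_ge0 eq_sym pn0.
move=> /iota_dense [h h0 hle].
suff : iota h <= 0 by move=> /(lt_le_trans h0); rewrite ltxx.
rewrite -(linear0 iota) iota_le; suff k : g <= g - h by apply: (rle_sub k); lin.
apply: lg => d Dd; rewrite -iota_le linearB.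
have : iota d <= rmeet (iota g) t.
  by apply: rmeet_glb; [rewrite iota_le ug|apply: ut; exists d].
by rewrite rmeet_rpos => k; apply: (rle_sub (rleD k hle)); lin.
Qed.

Lemma iota_supremums_inv (D : set E) g :
  supremums (iota @` D) (iota g) -> supremums D g.
Proof.
move=> [ug lg]; split=> [h Dh|h uh]; first by rewrite -iota_le ug //; exists h.
by rewrite -iota_le; apply: lg => _ [d /uh dh <-]; rewrite iota_le.
Qed.

(** If [t] bounds the elements of [E] below [x] and [h] fits into the gap
    between [t] and [x], then every multiple of [h] is below [x]. *)
Lemma iota_sup_below x : 0 <= x ->
  supremums (iota @` [set g | 0 <= g /\ iota g <= x]) x.
Proof.
move=> x0; split=> [_ [g [_ gx] <-] //|t ut].
suff p0 : rpos (x - t) = 0 by apply: (rle_sub (rpos0_le p0)); lin.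
apply: contrapT => /eqP pn0; have : 0 < rpos (x - t).
  by rewrite lt_neqAle rpos_ge0 eq_sym pn0.
move=> /iota_dense [h h0 hle].
suff : iota h <= 0 by move=> /(lt_le_trans h0); rewrite ltxx.
apply: (archimedean_le (y := x)) => k; rewrite -linearZZ.
suff [] : 0 <= k%:R *: h /\ iota (k%:R *: h) <= x by [].
elim: k => [|k [IHk0 IHkx]]; first by rewrite scale0r linear0.
have hge0 : 0 <= h by rewrite -iota_ge0 ltW.
split; first by rewrite rscale_ge0.
have : iota (k%:R *: h) <= rmeet x t.
  by apply: rmeet_glb => //; apply: ut; exists (k%:R *: h).
rewrite rmeet_rpos !linearZZ => k1.
by apply: (rle_sub (rleD k1 hle)); lin.
Qed.

(** The elements of [E] below [x] have a supremum in [E] by Dedekind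
    completeness, and that supremum is [x] by order density. *)
Lemma iota_solid x g : 0 <= x -> x <= iota g -> exists2 h, 0 <= h & iota h = x.
Proof.
move=> x0 xg; have sx := iota_sup_below x0.
have [||h sh] := @supremum_exists _ _ _ [set h | 0 <= h /\ iota h <= x] g.
- by exists 0; split; rewrite ?linear0.
- by move=> h [_ hx]; rewrite -iota_le (le_trans hx).
exists h; last exact: supremums_unique (iota_supremums sh) sx.
by have [uh _] := sh; apply: uh; split; rewrite ?linear0.
Qed.

Lemma iota_meet_exists g x : 0 <= g -> 0 <= x ->
  exists2 h, 0 <= h & iota h = rmeet (iota g) x.
Proof.
by move=> g0 x0; apply: (iota_solid (g := g)); rewrite ?rmeetl ?rmeet_ge0 ?iota_ge0.
Qed.

(** Distributivity in [Eu], read in [E]: the meets belong to [E] by solidity. *)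
Lemma iota_meet_supremums (D : set Eu) s g : (forall x, D x -> 0 <= x) ->
  0 <= g -> supremums D s -> iota g <= s ->
  supremums [set h | 0 <= h /\ exists2 x, D x & iota h = rmeet (iota g) x] g.
Proof.
move=> D0 g0 sD gs; apply: iota_supremums_inv.
have := supremums_meet (iota g) sD; rewrite (rmeet_l gs).
congr (supremums _ _); apply/seteqP.
split=> [_ [x Dx <-]|_ [h [_ [x Dx hE]] <-]]; last by exists x.
have [h h0 hE] := iota_meet_exists g0 (D0 x Dx).
by exists h => //; split=> //; exists x.
Qed.

End UniversalCompletion.

(** * The sup-completion *)

Section SupCompletion.
Context {R : realType} {E : rieszType R} {e : E} {Eu : fAlgType R}.
Context {iota : {linear E -> Eu}} {Es : orderedConeType R} {sig : E -> Es}.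
Context {dcE : dedekind_complete [set: E]}
  {ucE : universal_completion e iota} {scE : sup_completion sig}.
Implicit Types (g h : E) (x y z s t : Eu) (r : Es).

Local Ltac lin := lin_over R.
Local Notation u2s := (u2s iota sig).
Local Notation s2u := (s2u iota sig).

Lemma sig_le g h : (sig g <= sig h) = (g <= h).
Proof. exact: sup_completion_le scE g h. Qed.

Lemma supremum_Es (D : set Es) : D !=set0 -> supremums D (supremum czero D).
Proof.
move=> D0; have [r rP] := sup_completion_top scE.
rewrite /supremum ifF; last by apply/negP => /eqP D00; move: D0; rewrite D00 => -[].
apply: xgetPex; have [|s [_ [us ls]]] :=
  sup_completion_complete scE (@subsetT _ D) D0; first by exists r.
by exists s; split=> // t ut; apply: ls.
Qed.

(** The supremum of [sig @` D] in [Es] is below [sig g], hence of the form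
    [sig g'] by solidity. *)
Lemma sig_lub (D : set E) g r : D !=set0 ->
  supremums D g -> (forall h, D h -> sig h <= r) -> sig g <= r.
Proof.
move=> [d Dd] [ug lg] ur.
have [ls us] := @supremum_Es (sig @` D) (ex_intro _ _ (ex_intro2 _ _ d Dd erefl)).
set s := supremum _ _ in ls us.
have sg : s <= sig g by apply: us => _ [h Dh <-]; rewrite sig_le ug.
have [g' _ g's] := sup_completion_solid scE sg.
apply: (@le_trans _ _ s); last by apply: us => _ [h Dh <-]; apply: ur.
rewrite -g's sig_le; apply: lg => h Dh; rewrite -sig_le g's.
by apply: ls; exists h.
Qed.

Lemma u2sP x : 0 <= x -> supremums (sig @` [set g | iota g <= x]) (u2s x).
Proof.
by move=> x0; apply: supremum_Es; exists (sig 0), 0; rewrite //= linear0.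
Qed.

(** By the meet property of the sup-completion, [g] is the supremum of its
    meets with the elements of [E] below [x]. *)
Lemma sig_le_u2s g x : 0 <= x -> (sig g <= u2s x) = (iota g <= x).
Proof.
move=> x0; apply/idP/idP => gx; last by have [us _] := u2sP x0; apply: us; exists g.
have A0 : [set h | iota h <= x] !=set0 by exists 0; rewrite /= linear0.
have [_ lm] := sup_completion_meet scE A0 (u2sP x0) gx.
suff sg : supremums [set rmeet g h | h in [set h | iota h <= x]] g.
  have [_ lg] := iota_supremums sg; apply: lg => _ [_ [h hx <-] <-].
  by rewrite iota_meet; apply: le_trans (rmeetr _ _) hx.
split=> [_ [h _ <-]|h uh]; first exact: rmeetl.
rewrite -sig_le; apply: lm => _ [k kx <-]; rewrite sig_le.
by apply: uh; exists k.
Qed.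

Lemma u2s_lub_le x r : 0 <= x ->
  (forall g, 0 <= g -> iota g <= x -> sig g <= r) -> u2s x <= r.
Proof.
move=> x0 h; have [_ ls] := u2sP x0; apply: ls => _ [g gx <-].
apply: (@le_trans _ _ (sig (rjoin g 0))); first by rewrite sig_le rjoinl.
apply: h; first exact: rjoinr.
by rewrite iota_join linear0; apply: rjoin_lub.
Qed.

Lemma u2s_le x y : 0 <= x -> 0 <= y -> (u2s x <= u2s y) = (x <= y).
Proof.
move=> x0 y0; apply/idP/idP => xy.
  have [_ lx] := iota_sup_below x0; apply: lx => _ [g [_ gx] <-].
  by rewrite -sig_le_u2s // (le_trans _ xy) // sig_le_u2s.
apply: u2s_lub_le => // g g0 gx; rewrite sig_le_u2s //; exact: le_trans gx xy.
Qed.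

Lemma u2s_inj x y : 0 <= x -> 0 <= y -> u2s x = u2s y -> x = y.
Proof.
by move=> x0 y0 xy; apply: le_anti; apply/andP; split; rewrite -u2s_le // xy.
Qed.

Lemma u2s_iota g : 0 <= g -> u2s (iota g) = sig g.
Proof.
move=> g0; have ig0 : 0 <= iota g by rewrite iota_ge0.
apply: le_anti; rewrite sig_le_u2s // lexx andbT.
by apply: u2s_lub_le => // h _; rewrite iota_le sig_le.
Qed.

Lemma u2s_lub (D : set Eu) s r : D !=set0 -> (forall d, D d -> 0 <= d) ->
  supremums D s -> (forall d, D d -> u2s d <= r) -> u2s s <= r.
Proof.
move=> [d0 Dd0] D0 sD uD; have [us _] := sD.
have s0 : 0 <= s by apply: le_trans (D0 _ Dd0) (us _ Dd0).
apply: u2s_lub_le => // g g0 gs.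
apply: (sig_lub _ (iota_meet_supremums D0 g0 sD gs)).
- have [h h0 hE] := iota_meet_exists g0 (D0 _ Dd0).
  by exists h; split=> //; exists d0.
- move=> h [h0 [d Dd e1]]; apply: le_trans (uD _ Dd).
  by rewrite sig_le_u2s ?D0 // e1 rmeetr.
Qed.

Lemma u2s_scale (c : R) x : 0 < c -> 0 <= x -> u2s (c *: x) <= cscale c (u2s x).
Proof.
move=> c0 x0; have cx0 : 0 <= c *: x by apply: rscale_ge0 => //; apply: ltW.
apply: u2s_lub_le => // g g0 gx; have e1 : g = c *: (c^-1 *: g).
  by rewrite scalerA mulfV ?gt_eqF ?scale1r.
rewrite e1 (sup_completionZ scE _ (ltW c0)); apply: cle_scale; first exact: ltW.
by rewrite sig_le_u2s // linearZZ rle_scaleV ?invr_gt0 // invrK.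
Qed.

Lemma s2u_u2s x : 0 <= x -> s2u (u2s x) = x.
Proof.
move=> x0; rewrite /s2u; case: xgetP => [y _ [y0 yx]|/(_ x)[]] //.
by apply: u2s_inj.
Qed.

Lemma u2s_le_supS (x : nat -> Eu) n : u2s (x n) <= supS (fun n => u2s (x n)).
Proof.
rewrite /supS; have [|us _] := @supremum_Es (range (fun n => u2s (x n))).
  by exists (u2s (x 0%N)), 0%N.
by apply: us; exists n.
Qed.

Lemma supS_le (x : nat -> Es) r : (forall n, x n <= r) -> supS x <= r.
Proof.
move=> h; have [|_ ls] := @supremum_Es (range x); first by exists (x 0%N), 0%N.
by apply: ls => _ [n _ <-].
Qed.

End SupCompletion.

(** * Conditional expectations on their natural domain *)

Section NaturalDomain.
Context {R : realType} {E : rieszType R} {e : E} {Eu : fAlgType R}.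
Context {iota : {linear E -> Eu}} {Es : orderedConeType R} {sig : E -> Es}.
Context {dcE : dedekind_complete [set: E]}
  {ucE : universal_completion e iota} {scE : sup_completion sig}.
Context {S : {linear E -> E}}.
Context {ceS : conditional_expectation e S}.
Implicit Types (g h : E) (x y z s t p : Eu) (D : set Eu).

Local Ltac lin := lin_over R.
Local Notation u2s := (u2s iota sig).
Local Notation s2u := (s2u iota sig).
Local Notation L1 := (L1 iota sig S).
Local Notation condU := (condU iota sig S).


Lemma ce_ge0 g : 0 <= g -> 0 <= S g.
Proof.
rewrite le_eqVlt => /predU1P[<-|g0]; first by rewrite linear0.
by have [h _ _ _ _] := ceS; apply/ltW/h.
Qed.

Lemma ce_mono g h : g <= h -> S g <= S h.
Proof.
move=> gh; have : 0 <= S (h - g) by apply/ce_ge0/(rle_sub gh); lin.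
by rewrite linearB => k; apply: (rle_sub k); lin.
Qed.

(** Order continuity for the net of the members of [A], indexed by
    themselves; the dominating net is [g - a]. *)
Lemma ce_supremums (A : set E) g : A !=set0 -> upward A ->
  supremums A g -> supremums (S @` A) (S g).
Proof.
move=> [a0 Aa0] uA [ug lg]; have [_ oc _ _ _] := ceS.
split=> [_ [h Ah <-]|t ut]; first exact/ce_mono/ug.
pose I := {h : E | A h}; pose le (i j : I) := sval i <= sval j.
have dI : directed le.
  split; [by exists (exist _ a0 Aa0)|by move=> i; apply: lexx| |].
    by move=> i j k; apply: le_trans.
  move=> [i Ai] [j Aj]; have [k Ak [ik jk]] := uA _ _ Ai Aj.
  by exists (exist _ k Ak).
have [|_ [y [_ _ [_ [ly y_inf]] yle]]] := oc I le sval g dI.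
  split=> //; exists (fun i => g - sval i); split=> //.
  - by move=> i j ij; apply: (rle_sub ij); lin.
  - split=> //; split=> [_ [[h Ah] _ <-]|b _ ub].
      by apply: (rle_sub (ug _ Ah)); rewrite /=; lin.
    suff k : g <= g - b by apply: (rle_sub k); lin.
    apply: lg => h Ah; have /ub k : range (fun i : I => g - sval i) (g - h).
      by exists (exist _ h Ah).
    by apply: (rle_sub k); lin.
  - move=> [h Ah] /=; rewrite -rabsN rabs_ge; last first.
      by apply: (rle_sub (ug _ Ah)); lin.
    by rewrite le_eqVlt; apply/predU1P; left; lin.
suff k : S g - t <= 0 by apply: (rle_sub k); lin.
apply: y_inf => // _ [[h Ah] _ <-].
apply: le_trans (yle (exist _ h Ah)).
apply: le_trans (rleN_abs _) => /=.
have k : S h <= t by apply: ut; exists h.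
by apply: (rle_sub k); lin.
Qed.

(** ** The extension to positive elements *)

(** Its supremum is the value at [x] of the extended operator; a bound of this
    set expresses that [x] belongs to the domain. *)
Definition below_image x : set Eu :=
  [set iota (S g) | g in [set g | 0 <= g /\ iota g <= x]].

Definition ext x : Eu := supremum 0 (below_image x).

Lemma below_image0 x : 0 <= x -> below_image x !=set0.
Proof. by move=> x0; exists (iota (S 0)), 0 => //; split; rewrite ?linear0. Qed.

Lemma extP x t : 0 <= x -> ubound (below_image x) t ->
  supremums (below_image x) (ext x).
Proof. by move=> x0 /supremumP -/(_ 0 (below_image0 x0)). Qed.

Lemma ext_lub x t : 0 <= x -> ubound (below_image x) t -> ext x <= t.
Proof. by move=> x0 ut; have [_ ls] := extP x0 ut; apply: ls. Qed.

Lemma ext_ub x t : 0 <= x -> ubound (below_image x) t ->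
  ubound (below_image x) (ext x).
Proof. by move=> x0 /(extP x0) []. Qed.

Lemma below_image_mono x y t : x <= y ->
  ubound (below_image y) t -> ubound (below_image x) t.
Proof.
by move=> xy ut _ [g [g0 gx] <-]; apply: ut; exists g => //; split=> //; apply: le_trans xy.
Qed.

Lemma below_image_ge0 x t : 0 <= x -> ubound (below_image x) t -> 0 <= t.
Proof.
by move=> x0; apply; exists 0; rewrite /= ?linear0 //; split.
Qed.

Lemma ext_ge0 x t : 0 <= x -> ubound (below_image x) t -> 0 <= ext x.
Proof. by move=> x0 /(ext_ub x0); apply: below_image_ge0. Qed.

Lemma ext_iotaP g : 0 <= g -> ubound (below_image (iota g)) (iota (S g)).
Proof.
by move=> g0 _ [h [h0 hg] <-]; rewrite iota_le ce_mono -?iota_le.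
Qed.

Lemma ext_iota g : 0 <= g -> ext (iota g) = iota (S g).
Proof.
move=> g0; have ub := ext_iotaP g0.
have ig0 : 0 <= iota g by rewrite iota_ge0.
apply: le_anti; rewrite (ext_lub ig0 ub) /=.
by apply: (ext_ub ig0 ub); exists g.
Qed.

(** Order continuity: a [g] below the supremum [s] is the supremum of its
    meets with the members of [D], and these meets belong to [E]. *)
Lemma below_image_supremums D s t : D !=set0 -> upward D ->
  (forall d, D d -> 0 <= d) -> supremums D s ->
  (forall d, D d -> ubound (below_image d) t) -> ubound (below_image s) t.
Proof.
move=> [d0 Dd0] uD D0 sD ut _ [g [g0 gs] <-].
have sA : supremums
    [set h | 0 <= h /\ exists2 d, D d & iota h = rmeet (iota g) d] g.
  exact: iota_meet_supremums D0 g0 sD gs.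
have [||_ ls] := iota_supremums (@ce_supremums _ g _ _ sA).
- have [h h0 e1] := iota_meet_exists g0 (D0 _ Dd0).
  by exists h; split=> //; exists d0.
- move=> h1 h2 [_ [d1 Dd1 e1]] [_ [d2 Dd2 e2]].
  have [d Dd [le1 le2]] := uD _ _ Dd1 Dd2.
  have [h h0 e3] := iota_meet_exists g0 (D0 _ Dd).
  exists h; first by split=> //; exists d.
  by rewrite -!(iota_le (iota := iota)) e1 e2 e3; split; apply: rmeet_mono.
apply: ls => _ [_ [h [h0 [d Dd e1]] <-] <-]; apply: (ut _ Dd).
by exists h => //; split=> //; rewrite e1 rmeetr.
Qed.

(** The Riesz decomposition of an element below [x + y] is obtained by taking
    its meet with [x], which belongs to [E]. *)
Lemma below_imageD x y a b : 0 <= x -> 0 <= y ->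
  ubound (below_image x) a -> ubound (below_image y) b ->
  ubound (below_image (x + y)) (a + b).
Proof.
move=> x0 y0 ua ub _ [g [g0 gxy] <-].
have ig0 : 0 <= iota g by rewrite iota_ge0.
have [h h0 e1] := iota_solid (rmeet_ge0 ig0 x0) (rmeetl _ _).
have -> : g = h + (g - h) by lin.
rewrite (linearD S) (linearD iota); apply: rleD; [apply: ua; exists h|apply: ub; exists (g - h)] => //.
  by split=> //; rewrite e1 rmeetr.
split.
  by rewrite -iota_ge0 linearB e1 rmeet_rpos; apply: (rle_sub (rpos_ge0 (iota g - x))); lin.
rewrite linearB e1 rmeet_rpos.
have k : rpos (iota g - x) <= y.
  by apply: rpos_le => //; apply: (rle_sub gxy); lin.
by apply: (rle_sub k); lin.
Qed.

Lemma extD x y a b : 0 <= x -> 0 <= y ->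
  ubound (below_image x) a -> ubound (below_image y) b ->
  ext (x + y) = ext x + ext y.
Proof.
move=> x0 y0 ua ub; have xy0 := raddr_ge0 x0 y0.
have uab := below_imageD x0 y0 ua ub.
apply: le_anti; apply/andP; split.
  by apply: ext_lub => //; apply: below_imageD => //; [apply: ext_ub ua|apply: ext_ub ub].
suff k : ext x <= ext (x + y) - ext y by apply: (rle_sub k); lin.
apply: ext_lub => // _ [g [g0 gx] <-].
suff k : ext y <= ext (x + y) - iota (S g) by apply: (rle_sub k); lin.
apply: ext_lub => // _ [h [h0 hy] <-].
have k : iota (S (g + h)) <= ext (x + y).
  apply: (ext_ub xy0 uab); exists (g + h) => //.
  by split; [apply: raddr_ge0|rewrite linearD; apply: rleD].
by apply: (rle_sub k); rewrite (linearD S) (linearD iota); lin.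
Qed.

Lemma below_imageZ (c : R) x a : 0 < c ->
  ubound (below_image x) a -> ubound (below_image (c *: x)) (c *: a).
Proof.
move=> c0 ua _ [g [g0 gx] <-]; have c'0 : 0 < c^-1 by rewrite invr_gt0.
rewrite -[c]invrK -rle_scaleV // -linearZZ -linearZZ; apply: ua.
exists (c^-1 *: g) => //; split; first by apply: rscale_ge0 => //; apply: ltW.
by rewrite linearZZ rle_scaleV // invrK.
Qed.

Lemma extZ (c : R) x a : 0 < c -> 0 <= x -> ubound (below_image x) a ->
  ext (c *: x) = c *: ext x.
Proof.
move=> c0 x0 ua; have cx0 : 0 <= c *: x by apply: rscale_ge0 => //; apply: ltW.
have uca := below_imageZ c0 ua.
apply: le_anti; apply/andP; split.
  by apply: ext_lub => //; apply: below_imageZ => //; apply: ext_ub ua.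
rewrite rle_scaleV //; apply: ext_lub => //.
have c'0 : 0 < c^-1 by rewrite invr_gt0.
have {1}-> : x = c^-1 *: (c *: x) by rewrite scalerA mulVf ?gt_eqF ?scale1r.
by apply: below_imageZ => //; apply: ext_ub uca.
Qed.

(** ** The sup-completion describes the same extension *)

Lemma condS_ext x a : 0 <= x -> ubound (below_image x) a ->
  condS sig S (u2s x) = u2s (ext x).
Proof.
move=> x0 ua; have ex0 := ext_ge0 x0 ua.
have e1 : [set sig (S g) | g in [set g | 0 <= g /\ sig g <= u2s x]] =
          u2s @` below_image x.
  apply/seteqP; split=> [_ [g [g0 gx] <-]|_ [_ [g [g0 gx] <-] <-]].
    exists (iota (S g)); last by rewrite u2s_iota ?ce_ge0.
    by exists g => //; split=> //; rewrite -sig_le_u2s.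
  exists g; first by split=> //; rewrite sig_le_u2s.
  by rewrite u2s_iota ?ce_ge0.
have D0 d : below_image x d -> 0 <= d.
  by move=> [g [g0 _] <-]; rewrite iota_ge0 ce_ge0.
have [d Dd] := below_image0 x0.
rewrite /condS e1; have [us ls] :=
  supremum_Es (ex_intro _ _ (ex_intro2 _ _ d Dd erefl) : u2s @` below_image x !=set0).
apply: le_anti; apply/andP; split.
  apply: ls => _ [b Db <-]; rewrite (u2s_le (D0 _ Db) ex0).
  exact: (ext_ub x0 ua).
apply: (u2s_lub _ D0 (extP x0 ua)); first by exists d.
by move=> b Db; apply: us; exists b.
Qed.

Lemma condS_bound x y : 0 <= x -> 0 <= y -> condS sig S (u2s x) = u2s y ->
  ubound (below_image x) y.
Proof.
move=> x0 y0 xy _ [g [g0 gx] <-]; rewrite -sig_le_u2s // -xy /condS.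
set D := [set _ | _ in _]; have Dg : D (sig (S g)).
  by exists g => //; split=> //; rewrite sig_le_u2s.
by have [us _] := supremum_Es (ex_intro _ _ Dg : D !=set0); apply: us.
Qed.

Lemma L1P x : L1 x <-> exists a, ubound (below_image (rabs x)) a.
Proof.
split=> [[y y0 xy]|[a ua]]; first by exists y; apply: condS_bound xy => //; apply: rabs_ge0.
exists (ext (rabs x)); first exact: ext_ge0 (rabs_ge0 x) ua.
by rewrite (condS_ext (rabs_ge0 x) ua).
Qed.

Lemma L1_ge0P x : 0 <= x -> L1 x <-> exists a, ubound (below_image x) a.
Proof. by move=> x0; rewrite L1P rabs_ge. Qed.

Lemma L1_le x y : rabs x <= rabs y -> L1 y -> L1 x.
Proof. by move=> xy /L1P [a ua]; apply/L1P; exists a; apply: below_image_mono ua. Qed.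

Lemma L1_abs x : L1 (rabs x) <-> L1 x.
Proof. by split; apply: L1_le; rewrite rabs_abs. Qed.

Lemma L1_rpos x : L1 x -> L1 (rpos x).
Proof. by apply: L1_le; rewrite [leLHS]rabs_ge ?rpos_ge0 // rpos_le_abs. Qed.

Lemma L1_rneg x : L1 x -> L1 (rneg x).
Proof. by apply: L1_le; rewrite [leLHS]rabs_ge ?rneg_ge0 // rneg_le_abs. Qed.

Lemma L1N x : L1 x -> L1 (- x).
Proof. by apply: L1_le; rewrite rabsN. Qed.

Lemma L1D x y : L1 x -> L1 y -> L1 (x + y).
Proof.
move=> /L1P [a ua] /L1P [b ub]; apply/L1P; exists (a + b).
apply: below_image_mono (rabsD x y) _.
by apply: below_imageD => //; apply: rabs_ge0.
Qed.

Lemma L1B x y : L1 x -> L1 y -> L1 (x - y).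
Proof. by move=> hx /L1N; apply: L1D. Qed.

Lemma L1Z_gt0 (c : R) x : 0 < c -> L1 x -> L1 (c *: x).
Proof.
move=> c0 /L1P [a ua]; apply/L1P; exists (c *: a); rewrite rabsZ ?ltW //.
exact: below_imageZ.
Qed.

Lemma L1_0 : L1 0.
Proof.
apply/(L1_ge0P (lexx 0)); exists (iota (S 0)).
by rewrite -(linear0 iota); apply: ext_iotaP.
Qed.

Lemma L1Z (c : R) x : L1 x -> L1 (c *: x).
Proof.
move=> hx; have [c0|c0|->] := ltgtP c 0; last by rewrite scale0r; apply: L1_0.
  have -> : c *: x = - ((- c) *: x) by lin.
  by apply/L1N/L1Z_gt0; rewrite ?oppr_gt0.
exact: L1Z_gt0.
Qed.

Lemma L1_iota g : L1 (iota g).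
Proof.
apply/(L1P (iota g)); rewrite -iota_abs.
by exists (iota (S (rabs g))); apply/ext_iotaP/rabs_ge0.
Qed.

Lemma L1_one : L1 fone.
Proof. by rewrite -iota_e; apply: L1_iota. Qed.

Lemma L1_comp p x : is_comp p -> L1 x -> L1 (p ** x).
Proof.
by move=> cp; apply: L1_le; rewrite comp_abs //; apply/comp_mul_le/rabs_ge0.
Qed.

Lemma L1_comp1 p : is_comp p -> L1 p.
Proof. by move=> cp; have := L1_comp cp L1_one; rewrite fmul1r. Qed.

Lemma L1_sum (x : nat -> Eu) n :
  (forall k, L1 (x k)) -> L1 (\sum_(k < n) x k).
Proof.
move=> hx; elim: n => [|n ih]; first by rewrite big_ord0; apply: L1_0.
by rewrite big_ord_recr; apply: L1D.
Qed.

Lemma condU_ext x : L1 x -> condU x = ext (rpos x) - ext (rneg x).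
Proof.
move=> hx; rewrite /condU.
have /(L1_ge0P (rpos_ge0 x)) [a ua] := L1_rpos hx.
have /(L1_ge0P (rneg_ge0 x)) [b ub] := L1_rneg hx.
rewrite (condS_ext (rpos_ge0 x) ua) (condS_ext (rneg_ge0 x) ub).
by rewrite !s2u_u2s // (ext_ge0 _ ua, ext_ge0 _ ub) // ?rpos_ge0 ?rneg_ge0.
Qed.

Lemma ext0 : ext 0 = 0.
Proof. by rewrite -(linear0 iota) ext_iota // !linear0. Qed.

Lemma condU_ge0E x : 0 <= x -> L1 x -> condU x = ext x.
Proof. by move=> x0 hx; rewrite condU_ext // rpos_ge // rneg_ge // ext0 subr0. Qed.

(** The value on a difference of positive elements does not depend on the
    difference chosen, by additivity. *)
Lemma condU_diff x y : 0 <= x -> 0 <= y -> L1 x -> L1 y ->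
  condU (x - y) = ext x - ext y.
Proof.
move=> x0 y0 hx hy; have hxy := L1B hx hy; rewrite condU_ext //.
set z := x - y.
have /(L1_ge0P (rpos_ge0 z)) [a ua] := L1_rpos hxy.
have /(L1_ge0P (rneg_ge0 z)) [b ub] := L1_rneg hxy.
have [c uc] := (L1_ge0P x0).1 hx; have [d ud] := (L1_ge0P y0).1 hy.
have h1 := extD (rpos_ge0 z) y0 ua ud; have h2 := extD (rneg_ge0 z) x0 ub uc.
have k : ext (rpos z) + ext y = ext (rneg z) + ext x.
  by rewrite -h1 -h2 rnegE /z; congr ext; lin.
have -> : ext (rpos z) = ext (rneg z) + ext x - ext y by rewrite -k; lin.
by lin.
Qed.

Lemma condUD x y : L1 x -> L1 y -> condU (x + y) = condU x + condU y.
Proof.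
move=> hx hy; rewrite (condU_ext hx) (condU_ext hy).
have -> : x + y = (rpos x + rpos y) - (rneg x + rneg y).
  by rewrite {1}(rpos_neg x) {1}(rpos_neg y); lin.
have [/L1_rpos hxp /L1_rneg hxn] := (hx, hx).
have [/L1_rpos hyp /L1_rneg hyn] := (hy, hy).
have [xp0 xn0] := (rpos_ge0 x, rneg_ge0 x).
have [yp0 yn0] := (rpos_ge0 y, rneg_ge0 y).
rewrite condU_diff ?raddr_ge0 //; try exact: L1D.
have [[a ua] [b ub]] := ((L1_ge0P xp0).1 hxp, (L1_ge0P xn0).1 hxn).
have [[c uc] [d ud]] := ((L1_ge0P yp0).1 hyp, (L1_ge0P yn0).1 hyn).
by rewrite (extD xp0 yp0 ua uc) (extD xn0 yn0 ub ud); lin.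
Qed.

Lemma condU0 : condU 0 = 0.
Proof. by rewrite condU_ge0E ?ext0 //; apply: L1_0. Qed.

Lemma condUN x : L1 x -> condU (- x) = - condU x.
Proof.
move=> hx; apply: (addrI (condU x)); rewrite -condUD ?subrr ?condU0 //.
exact: L1N.
Qed.

Lemma condUB x y : L1 x -> L1 y -> condU (x - y) = condU x - condU y.
Proof. by move=> hx hy; rewrite condUD ?condUN //; apply: L1N. Qed.

Lemma condUZ_gt0 (c : R) x : 0 < c -> L1 x -> condU (c *: x) = c *: condU x.
Proof.
move=> c0 hx; rewrite (condU_ext hx).
have [hxp hxn] := (L1_rpos hx, L1_rneg hx).
have [xp0 xn0] := (rpos_ge0 x, rneg_ge0 x).
rewrite {1}(rpos_neg x).
have cge0 := ltW c0.
rewrite scalerBr (condU_diff (rscale_ge0 cge0 xp0) (rscale_ge0 cge0 xn0) (L1Z c hxp) (L1Z c hxn)).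
have [[a ua] [b ub]] := ((L1_ge0P xp0).1 hxp, (L1_ge0P xn0).1 hxn).
by rewrite (extZ c0 xp0 ua) (extZ c0 xn0 ub); lin.
Qed.

Lemma condU_ge0 x : 0 <= x -> L1 x -> 0 <= condU x.
Proof.
move=> x0 hx; rewrite condU_ge0E //; have [a ua] := (L1_ge0P x0).1 hx.
exact: ext_ge0 ua.
Qed.

Lemma condU_mono x y : L1 x -> L1 y -> x <= y -> condU x <= condU y.
Proof.
move=> hx hy xy; have k : 0 <= condU (y - x).
  by apply: condU_ge0; [apply: (rle_sub xy); lin|apply: L1B].
by apply: (rle_sub k); rewrite condUB //; lin.
Qed.

Lemma condU_abs x : L1 x -> rabs (condU x) <= condU (rabs x).
Proof.
move=> hx; have hax := (L1_abs x).2 hx; apply: rabs_lub.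
  by apply: condU_mono => //; apply: rle_abs.
by rewrite -condUN //; apply: condU_mono (rleN_abs _) => //; apply: L1N.
Qed.

Lemma condU_iota g : 0 <= g -> condU (iota g) = iota (S g).
Proof.
move=> g0; rewrite condU_ge0E ?ext_iota //; last exact: L1_iota.
by rewrite iota_ge0.
Qed.

Lemma condU_one : condU fone = fone.
Proof.
have e0 : 0 <= e by rewrite -iota_ge0 iota_e fone_ge0.
by rewrite -iota_e condU_iota //; have [_ _ _ _ ->] := ceS.
Qed.

Lemma condU_boundP x t : 0 <= x ->
  ubound (below_image x) t <-> L1 x /\ condU x <= t.
Proof.
move=> x0; split=> [ut|[hx xt]].
  have hx : L1 x by apply/(L1_ge0P x0); exists t.
  by split=> //; rewrite condU_ge0E //; apply: ext_lub.
have [a ua] := (L1_ge0P x0).1 hx; move=> y /(ext_ub x0 ua) ye.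
by apply: le_trans ye _; rewrite -condU_ge0E.
Qed.

Lemma condU_supremums D s t : D !=set0 -> upward D ->
  (forall d, D d -> 0 <= d) -> supremums D s ->
  (forall d, D d -> L1 d /\ condU d <= t) -> L1 s /\ condU s <= t.
Proof.
move=> Dn uD D0 sD h; have s0 : 0 <= s.
  by have [d Dd] := Dn; have [us _] := sD; apply: le_trans (D0 _ Dd) (us _ Dd).
apply/(condU_boundP _ s0); apply: (below_image_supremums Dn uD D0 sD) => d Dd.
by apply/condU_boundP; [apply: D0|apply: h].
Qed.

(** By order density a positive [x] dominates a positive element of [E], to
    which strict positivity on [E] applies. *)
Lemma condU_strict x : 0 <= x -> L1 x -> condU x <= 0 -> x = 0.
Proof.
move=> x0 hx xle; apply: contrapT => /eqP xn0.
have /iota_dense [g g0 gx] : 0 < x by rewrite lt_neqAle x0 eq_sym xn0.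
have gp : 0 < g by rewrite -iota_gt0.
have : 0 < iota (S g) by rewrite iota_gt0; have [h _ _ _ _] := ceS; apply: h.
suff le0 : iota (S g) <= 0 by move=> /lt_le_trans /(_ le0); rewrite ltxx.
apply: le_trans xle; rewrite -(condU_iota (ltW gp)).
by apply: condU_mono => //; apply: L1_iota.
Qed.

Lemma upward_below_image x : upward (below_image x).
Proof.
move=> _ _ [g [g0 gx] <-] [h [h0 hx] <-]; exists (iota (S (rjoin g h))).
  exists (rjoin g h) => //; split; first exact: le_trans g0 (rjoinl _ _).
  by rewrite iota_join rjoin_lub.
by split; rewrite iota_le ce_mono ?rjoinl ?rjoinr.
Qed.

End NaturalDomain.

Section Composition.
Context {R : realType} {E : rieszType R} {e : E} {Eu : fAlgType R}.
Context {iota : {linear E -> Eu}} {Es : orderedConeType R} {sig : E -> Es}.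
Context {dcE : dedekind_complete [set: E]}
  {ucE : universal_completion e iota} {scE : sup_completion sig}.
Context {S1 S2 S3 : {linear E -> E}}.
Context {ce1 : conditional_expectation e S1}
  {ce2 : conditional_expectation e S2} {ce3 : conditional_expectation e S3}.
Hypothesis comp123 : forall g, S1 (S2 g) = S3 g.
Implicit Types (g : E) (x : Eu).

Local Ltac lin := lin_over R.
Local Notation L1 := (L1 iota sig).
Local Notation condU := (condU iota sig).

(** [condU S2 x] is a directed supremum of elements of [E], along which
    [condU S1] is order continuous; on [E] the tower property is given. *)
Lemma condU_comp_ge0 x : 0 <= x -> L1 S2 x -> L1 S3 x ->
  L1 S1 (condU S2 x) /\ condU S1 (condU S2 x) = condU S3 x.
Proof.
move=> x0 hx2 hx3; set D := below_image (iota := iota) (S := S2) x.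
have [a ua] := (L1_ge0P (S := S2) x0).1 hx2.
have Dn : D !=set0 by apply: below_image0.
have D0 d : D d -> 0 <= d.
  by move=> [g [g0 _] <-]; rewrite iota_ge0 (ce_ge0 (S := S2)).
have sD : supremums D (condU S2 x).
  by rewrite (condU_ge0E (S := S2)) //; apply: (extP x0 ua).
have e13 g : 0 <= g -> condU S1 (iota (S2 g)) = condU S3 (iota g).
  move=> g0; rewrite (condU_iota (S := S1)) ?(ce_ge0 (S := S2)) //.
  by rewrite (condU_iota (S := S3)) // comp123.
have [h1 h2] : L1 S1 (condU S2 x) /\ condU S1 (condU S2 x) <= condU S3 x.
  apply: (condU_supremums (S := S1) Dn _ D0 sD).
    exact: upward_below_image.
  move=> _ [g [g0 gx] <-]; split; first exact: (L1_iota (S := S1)).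
  rewrite e13 //; apply: (condU_mono (S := S3)) gx => //.
  exact: (L1_iota (S := S3)).
split=> //; apply: le_anti; rewrite h2 /= [leLHS](condU_ge0E (S := S3)) //.
apply: ext_lub => // _ [g [g0 gx] <-].
rewrite -(condU_iota (S := S3)) // -e13 //.
apply: (condU_mono (S := S1)) => //; first exact: (L1_iota (S := S1)).
by have [us _] := sD; apply: us; exists g.
Qed.

Lemma condU_comp x : L1 S2 x -> L1 S3 x ->
  L1 S1 (condU S2 x) /\ condU S1 (condU S2 x) = condU S3 x.
Proof.
move=> hx2 hx3.
have [hp2 hn2] := (L1_rpos (S := S2) hx2, L1_rneg (S := S2) hx2).
have [hp3 hn3] := (L1_rpos (S := S3) hx3, L1_rneg (S := S3) hx3).
have [h1 e1] := condU_comp_ge0 (rpos_ge0 x) hp2 hp3.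
have [h2 e2] := condU_comp_ge0 (rneg_ge0 x) hn2 hn3.
rewrite (rpos_neg x) (condUB (S := S2)) // (condUB (S := S3)) //.
split; first exact: (L1B (S := S1)).
by rewrite (condUB (S := S1)) // e1 e2.
Qed.

End Composition.

Section FixedElements.
Context {R : realType} {E : rieszType R} {e : E} {Eu : fAlgType R}.
Context {iota : {linear E -> Eu}} {Es : orderedConeType R} {sig : E -> Es}.
Context {dcE : dedekind_complete [set: E]}
  {ucE : universal_completion e iota} {scE : sup_completion sig}.
Context {S : {linear E -> E}}.
Context {ceS : conditional_expectation e S}.
Implicit Types (g h : E) (x y z s t p : Eu) (D : set Eu).

Local Ltac lin := lin_over R.
Local Notation L1 := (L1 iota sig S).
Local Notation condU := (condU iota sig S).


Lemma condU_idem x : L1 x -> L1 (condU x) /\ condU (condU x) = condU x.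
Proof.
move=> hx; have [_ _ idem _ _] := ceS.
exact: (condU_comp idem).
Qed.

(** ** Fixed elements *)

Definition fixed x := L1 x /\ condU x = x.

Lemma fixedD x y : fixed x -> fixed y -> fixed (x + y).
Proof. by move=> [hx ex] [hy ey]; split; [apply: L1D|rewrite condUD // ex ey]. Qed.

Lemma fixedN x : fixed x -> fixed (- x).
Proof. by move=> [hx ex]; split; [apply: L1N|rewrite condUN // ex]. Qed.

Lemma fixedB x y : fixed x -> fixed y -> fixed (x - y).
Proof. by move=> fx /fixedN; apply: fixedD. Qed.

Lemma fixed0 : fixed 0.
Proof. by split; [apply: L1_0|rewrite condU0]. Qed.

Lemma fixedZ (c : R) x : 0 <= c -> fixed x -> fixed (c *: x).
Proof.
rewrite le_eqVlt => /predU1P[<- _|c0 [hx ex]]; first by rewrite scale0r; apply: fixed0.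
by split; [apply: L1Z|rewrite condUZ_gt0 // ex].
Qed.

Lemma fixed_one : fixed fone.
Proof. by split; [apply: L1_one|apply: condU_one]. Qed.

(** [condU (rabs x) - rabs x] is positive and has conditional expectation 0,
    so strict positivity applies. *)
Lemma fixed_abs x : fixed x -> fixed (rabs x).
Proof.
move=> [hx ex]; have hax : L1 (rabs x) by apply/L1_abs.
split=> //.
have [h1 h2] := condU_idem hax.
have k : rabs x <= condU (rabs x) by rewrite -{1}ex; apply: condU_abs.
apply/eqP; rewrite -subr_eq0; apply/eqP; apply: condU_strict.
- by apply: (rle_sub k); lin.
- exact: L1B.
- by rewrite condUB // h2 subrr.
Qed.

Lemma fixed_supremums D s : D !=set0 -> upward D ->
  (forall d, D d -> 0 <= d) -> supremums D s -> (forall d, D d -> fixed d) ->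
  fixed s.
Proof.
move=> Dn uD D0 sD fD; have [us ls] := sD.
have [hs se] : L1 s /\ condU s <= s.
  apply: (condU_supremums Dn uD D0 sD) => d Dd.
  by have [hd ->] := fD _ Dd; split=> //; apply: us.
split=> //; apply: le_anti; rewrite se /=.
apply: ls => d Dd; have [hd <-] := fD _ Dd.
by apply: condU_mono => //; apply: us.
Qed.



Lemma fixed_rpos x : fixed x -> fixed (rpos x).
Proof.
move=> fx; have -> : rpos x = 2^-1 *: (x + rabs x).
  have -> : x + rabs x = 2 *: rpos x by rewrite rabsE rnegE; lin.
  by rewrite scalerA mulVf ?scale1r // pnatr_eq0.
by apply: fixedZ; [rewrite invr_ge0|apply/fixedD/fixed_abs].
Qed.

Lemma fixed_meet x y : fixed x -> fixed y -> fixed (rmeet x y).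
Proof. by move=> fx fy; rewrite rmeet_rpos; apply/fixedB/fixed_rpos/fixedB. Qed.

(** The truncations whose supremum is [posc x] are lattice expressions in [x]
    and the unit. *)
Lemma fixed_posc x : fixed x -> fixed (posc x).
Proof.
move=> fx; pose a k := rmeet (k%:R *: rpos x) (fone : Eu).
apply: (@fixed_supremums (range a)); last 2 first.
- exact: poscP.
- move=> _ [k _ <-]; apply: fixed_meet fixed_one.
  by apply: fixedZ => //; apply: fixed_rpos.
- by exists (a 0%N), 0%N.
- apply: upward_nondecreasing => k; apply: rmeet_mono => //.
  by apply: (rle_scalel _ (rpos_ge0 x)); rewrite ler_nat.
- move=> _ [k _ <-]; rewrite rmeet_ge0 ?fone_ge0 //.
  by rewrite rscale_ge0 ?rpos_ge0.
Qed.

(** ** Averaging *)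

(** The band of [p] is invariant: this is clear for elements below a multiple
    of [p], and [p ** x] is the supremum of such elements. *)
Lemma condU_band p x : is_comp p -> fixed p -> 0 <= x -> L1 x ->
  p ** condU (p ** x) = condU (p ** x).
Proof.
move=> cp fp x0 hx; have hpx : L1 (p ** x) by apply: L1_comp.
have cpx0 : 0 <= condU (p ** x) by apply: condU_ge0 => //; apply: comp_mul_ge0.
apply: le_anti; rewrite comp_mul_le //=.
pose a (k : nat) := rmeet x (k%:R *: (fone : Eu)).
have a0 k : 0 <= a k by rewrite rmeet_ge0 // rscale_ge0 ?fone_ge0.
have ha k : L1 (a k).
  by apply: (L1_le _ hx); rewrite !rabs_ge //; apply: rmeetl.
have sD : supremums [set p ** d | d in range a] (p ** x).
  exact: comp_mul_supremums cp (supremums_trunc x0).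
suff [] : L1 (p ** x) /\ condU (p ** x) <= p ** condU (p ** x) by [].
apply: (condU_supremums _ _ _ sD).
- by exists (p ** a 0%N), (a 0%N) => //; exists 0%N.
- move=> _ _ [_ [i _ <-] <-] [_ [j _ <-] <-].
  have ai k l : (k <= l)%N -> p ** a k <= p ** a l.
    move=> kl; apply: comp_mono => //; apply: rmeet_mono => //.
    by apply: rle_scalel; rewrite ?fone_ge0 ?ler_nat.
  exists (p ** a (maxn i j)); first by exists (a (maxn i j)) => //; exists (maxn i j).
  by rewrite !ai ?leq_maxl ?leq_maxr.
- by move=> _ [_ [k _ <-] <-]; apply: comp_mul_ge0.
- move=> _ [_ [k _ <-] <-]; have hpa : L1 (p ** a k) by apply: L1_comp.
  split=> //; have <- : p ** condU (p ** a k) = condU (p ** a k).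
    apply: (comp_fix_le cp (y := k%:R *: p)).
    + by apply: condU_ge0 => //; apply: comp_mul_ge0.
    + have [hkp <-] : fixed (k%:R *: p) by apply: fixedZ.
      apply: condU_mono => //; rewrite -[p in leRHS]fmul1r -fmulZr.
      by apply: comp_mono => //; apply: rmeetr.
    + by rewrite fmulZr comp_idem.
  apply: comp_mono => //; apply: condU_mono => //.
  by apply: comp_mono => //; apply: rmeetl.
Qed.

(** Both [p ** x] and its complement keep to their bands. *)
Lemma condU_averaging p x : is_comp p -> fixed p -> L1 x ->
  condU (p ** x) = p ** condU x.
Proof.
move=> cp fp; wlog x0 : x / 0 <= x.
  move=> wh hx; have [hxp hxn] : L1 (rpos x) /\ L1 (rneg x).
    by split; [apply: L1_rpos|apply: L1_rneg].
  have [hpp hpn] : L1 (p ** rpos x) /\ L1 (p ** rneg x).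
    by split; apply: L1_comp.
  rewrite (rpos_neg x) fmulDrr fmulNr !condUB //.
  by rewrite !wh ?rpos_ge0 ?rneg_ge0 // fmulDrr fmulNr.
move=> hx; have c'p := compC cp.
have f'p : fixed (fone - p) by apply: fixedB fp; apply: fixed_one.
have [hpx hp'x] : L1 (p ** x) /\ L1 ((fone - p) ** x) by split; apply: L1_comp.
have xE : x = p ** x + (fone - p) ** x by rewrite !fmulE; lin.
rewrite [in RHS]xE condUD // fmulDrr condU_band // -(condU_band c'p) //.
rewrite comp_mulC0 ?addr0 //.
by apply: condU_ge0 => //; apply: comp_mul_ge0.
Qed.

(** ** Monotone convergence *)

Lemma disjoint_by_comp p x y : is_comp p -> 0 <= x -> 0 <= y ->
  p ** x = x -> (fone - p) ** y = y -> rmeet x y = 0.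
Proof.
move=> cp x0 y0 px py; have m0 := rmeet_ge0 x0 y0.
rewrite -(comp_fix_le cp m0 (rmeetl _ _) px).
by rewrite -(comp_fix_le (compC cp) m0 (rmeetr _ _) py) comp_mulC0.
Qed.

(** Let [p k] be the component on which [D] exceeds [k]. By Chebyshev's
    inequality the [p k] decrease to 0, so that the components on which [k] is
    the first natural number that bounds [D] exhaust the unit. On each of
    them [D] is bounded by a multiple of the unit, and lateral completeness
    glues these bounds together. *)
Lemma condU_bounded D y : D !=set0 -> upward D -> (forall d, D d -> 0 <= d) ->
  (forall d, D d -> L1 d /\ condU d <= y) -> exists b, ubound D b.
Proof.
move=> [d0 Dd0] uD D0 hD.
pose P k := [set posc (d - k%:R *: fone) | d in D].
pose p k := supremum 0 (P k).
have Pn k : P k !=set0 by exists (posc (d0 - k%:R *: fone)), d0.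
have pP k : supremums (P k) (p k).
  by apply: (@supremumP _ _ _ _ _ fone) => // _ [d _ <-]; apply: posc_le1.
have cp k : is_comp (p k).
  by apply: comp_supremums (Pn k) _ (pP k) => _ [d _ <-]; apply: posc_comp.
have pd k d : D d -> posc (d - k%:R *: fone) <= p k.
  by move=> Dd; have [us _] := pP k; apply: us; exists d.
have hp k : L1 (p k) by apply: L1_comp1.
have Ep k : k.+1%:R *: condU (p k.+1) <= y.
  have k0 : (0 : R) < k.+1%:R by rewrite ltr0n.
  rewrite rle_scaleV //.
  suff [] : L1 (p k.+1) /\ condU (p k.+1) <= k.+1%:R^-1 *: y by [].
  apply: (condU_supremums _ _ _ (pP k.+1)) => //.
  - move=> _ _ [a Da <-] [b Db <-]; have [c Dc [ac bc]] := uD _ _ Da Db.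
    exists (posc (c - k.+1%:R *: fone)); first by exists c.
    by split; apply: posc_mono; apply: rler_wD2r.
  - by move=> _ [d _ <-]; apply: posc_ge0.
  - move=> _ [d Dd <-]; have hc : L1 (posc (d - k.+1%:R *: fone)).
      by apply/L1_comp1/posc_comp.
    split=> //; rewrite -rle_scaleV // -condUZ_gt0 //.
    have [hd dy] := hD _ Dd; apply: le_trans dy.
    by apply: condU_mono; rewrite ?posc_chebyshev ?D0 //; apply: L1Z.
have p_inf z : (forall k, z <= p k) -> z <= 0.
  move=> zp; apply: rpos0_le.
  have zp' k : rpos z <= p k by apply: rpos_le => //; apply: comp_ge0.
  have hz : L1 (rpos z).
    apply: (L1_le _ (hp 0%N)); rewrite !rabs_ge ?rpos_ge0 //; exact: comp_ge0.
  apply: condU_strict => //; first exact: rpos_ge0.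
  apply: (archimedean_le (y := y)) => -[|k].
    rewrite scale0r; have [hd dy] := hD _ Dd0.
    by apply: le_trans dy; apply: condU_ge0 => //; apply: D0.
  by apply: le_trans (Ep k); apply: rle_scale => //; apply: condU_mono.
pose r k := fone - p k; have cr k : is_comp (r k) by apply: compC.
have rS k : r k <= r k.+1.
  suff h : p k.+1 <= p k by apply: (rle_sub h); rewrite /r; lin.
  have [_ ls] := pP k.+1; apply: ls => _ [d Dd <-].
  apply: le_trans (pd k d Dd); apply: posc_mono.
  have h : k%:R *: fone <= k.+1%:R *: fone :> Eu.
    by apply: rle_scalel; rewrite ?fone_ge0 ?ler_nat.
  by apply: (rle_sub h); lin.
(* [q k] is the component on which [k] is the first natural number that
   bounds [D]. *)
pose q k := if k is i.+1 then r k - r i else r 0%N.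
have cq k : is_comp (q k) by case: k => [|k]; [apply: cr|apply: compB].
have qr k : q k <= r k.
  case: k => [|k]; first exact: lexx.
  by apply: (rle_sub (comp_ge0 (cr k))); rewrite /q; lin.
have qC k : (fone - r k) ** q k.+1 = q k.+1.
  rewrite -[RHS]comp_idem // comp_le_mul // ?comp_idem //.
    exact: compC.
  by apply: (rle_sub (comp_le1 (cr k.+1))); rewrite /q; lin.
have qdisj i j : (i < j)%N -> rmeet (i%:R *: q i) (j%:R *: q j) = 0.
  case: j => // j ij; apply: (disjoint_by_comp (cr j)).
  - by rewrite rscale_ge0 // comp_ge0.
  - by rewrite rscale_ge0 // comp_ge0.
  - by rewrite fmulZr comp_le_mul // (le_trans (qr i)) ?(nondecreasing_le rS).
  - by rewrite fmulZr qC.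
have [] := @latU _ _ _ _ _ _ (range (fun k => k%:R *: q k)).
- by exists (0%:R *: q 0%N), 0%N.
- by move=> _ [k _ <-]; rewrite rscale_ge0 // comp_ge0.
- move=> _ _ [i _ <-] [j _ <-] ij; rewrite /rdisjoint.
  rewrite !rabs_ge ?rscale_ge0 ?comp_ge0 //.
  case: (ltngtP i j) => [lt_ij|lt_ji|eq_ij]; first exact: qdisj.
    by rewrite rmeetC qdisj.
  by case: ij; rewrite eq_ij.
move=> b [ub _]; exists b => d Dd; have dge0 := D0 _ Dd.
have qd k : q k ** d <= b.
  apply: (@le_trans _ _ (k%:R *: q k)); last by apply: ub; exists k.
  set c := fone - posc (d - k%:R *: fone).
  have cc : is_comp c by apply/compC/posc_comp.
  have qc : q k <= c.
    apply: le_trans (qr k) _; apply: (rle_sub (pd k d Dd)); rewrite /r /c; lin.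
  have qcE : q k ** c = q k by rewrite comp_comm // comp_le_mul.
  rewrite -{1}qcE -fmulA; apply: le_trans (comp_mono (cq k) (poscC_le _ _)) _.
  by rewrite fmulZr -/c qcE.
have rd k : r k ** d <= b.
  elim: k => [|k ih]; first exact: (qd 0%N).
  have -> : r k.+1 ** d = r k ** d + q k.+1 ** d by rewrite /q !fmulE; lin.
  apply: disjoint_add_le => //; apply: (disjoint_by_comp (cr k)).
  - exact: comp_mul_ge0.
  - exact: comp_mul_ge0.
  - by rewrite fmulA comp_idem.
  - by rewrite fmulA qC.
suff h : rpos (d - b) = 0 by apply: (rle_sub (rpos0_le h)); lin.
apply: (comp_mul_inf0 cp dge0) => //; first exact: rpos_ge0.
move=> k; apply: rpos_le; last exact: comp_mul_ge0.
by apply: (rle_sub (rd k)); rewrite /r !fmulE; lin.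
Qed.

End FixedElements.

(** * Filtrations and martingales *)

Existing Class filtration.

Section Filtration.
Context {R : realType} {E : rieszType R} {e : E} {Eu : fAlgType R}.
Context {iota : {linear E -> Eu}} {Es : orderedConeType R} {sig : E -> Es}.
Context {dcE : dedekind_complete [set: E]}
  {ucE : universal_completion e iota} {scE : sup_completion sig}.
Context {T : nat -> {linear E -> E}} {fT : filtration e T}.
Implicit Types (x y p q : Eu) (d : nat -> Eu).

Local Ltac lin := lin_over R.
Local Notation L := (L1 iota sig (T 0%N)).
Local Notation tau n := (condU iota sig (T n)).
Local Notation fixed n := (fixed (iota := iota) (sig := sig) (S := T n)).

#[export] Instance filtration_ce n : conditional_expectation e (T n).
Proof. by have [h _] := fT. Qed.

Lemma filtration_comp i j g : T i (T j g) = T (minn i j) g.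
Proof.
have [_ h] := fT; have [ij|/ltnW ji] := leqP i j.
  by have [_ ->] := h _ _ ij g.
by have [-> _] := h _ _ ji g.
Qed.

(** Because [T 0 (T n g) = T 0 g], a set on which [T 0] is bounded has an image
    under [T n] on which [T 0] is bounded, and monotone convergence applies to
    that image. *)
Lemma L1_filtration n x : L x -> L1 iota sig (T n) x.
Proof.
move=> hx; have ha : L (rabs x) by apply/L1_abs.
apply/(L1P (ceS := filtration_ce n)).
apply: (condU_bounded (S := T 0%N) (y := tau 0 (rabs x))).
- by apply/below_image0/rabs_ge0.
- exact: upward_below_image.
- by move=> _ [g [g0 _] <-]; rewrite iota_ge0 (ce_ge0 (S := T n)).
- move=> _ [g [g0 gx] <-]; split; first exact: L1_iota.
  rewrite condU_iota ?(ce_ge0 (S := T n)) // filtration_comp min0n -condU_iota //.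
  by apply: condU_mono => //; apply: L1_iota.
Qed.

Lemma tower i j x : L x -> tau i (tau j x) = tau (minn i j) x.
Proof.
move=> hx.
have [] // := condU_comp (S1 := T i) (S2 := T j) (S3 := T (minn i j))
  (filtration_comp i j) (x := x); exact: L1_filtration.
Qed.

Lemma tau_L n x : L x -> L (tau n x).
Proof.
move=> hx; have hn := @filtration_comp 0%N n; rewrite min0n in hn.
have [] // := condU_comp (S1 := T 0%N) (S2 := T n) (S3 := T 0%N) hn (x := x).
exact: L1_filtration.
Qed.

Lemma tau0_tau n x : L x -> tau 0 (tau n x) = tau 0 x.
Proof. by move=> hx; rewrite tower // min0n. Qed.

Lemma tauD n x y : L x -> L y -> tau n (x + y) = tau n x + tau n y.
Proof. by move=> hx hy; apply: condUD; apply: L1_filtration. Qed.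

Lemma tauB n x y : L x -> L y -> tau n (x - y) = tau n x - tau n y.
Proof. by move=> hx hy; apply: condUB; apply: L1_filtration. Qed.

Lemma tau_mono n x y : L x -> L y -> x <= y -> tau n x <= tau n y.
Proof. by move=> hx hy; apply: condU_mono; apply: L1_filtration. Qed.

Lemma tau_ge0 n x : L x -> 0 <= x -> 0 <= tau n x.
Proof. by move=> hx x0; apply: condU_ge0 => //; apply: L1_filtration. Qed.

Lemma tau_abs n x : L x -> rabs (tau n x) <= tau n (rabs x).
Proof. by move=> hx; apply: condU_abs; apply: L1_filtration. Qed.

Definition adapted n x := L x /\ tau n x = x.

Lemma adapted_fixed n x : adapted n x -> fixed n x.
Proof. by move=> [hx ex]; split=> //; apply: L1_filtration. Qed.

Lemma adapted_le i j x : (i <= j)%N -> adapted i x -> adapted j x.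
Proof.
by move=> ij [hx ex]; split=> //; rewrite -{1}ex tower // (minn_idPr ij).
Qed.

Lemma adaptedD n x y : adapted n x -> adapted n y -> adapted n (x + y).
Proof. by move=> [hx ex] [hy ey]; split; [apply: L1D|rewrite tauD // ex ey]. Qed.

Lemma adaptedB n x y : adapted n x -> adapted n y -> adapted n (x - y).
Proof. by move=> [hx ex] [hy ey]; split; [apply: L1B|rewrite tauB // ex ey]. Qed.

Lemma adapted_abs n x : adapted n x -> adapted n (rabs x).
Proof.
move=> ax; have [_ ex] := fixed_abs (adapted_fixed ax); split=> //.
by apply/L1_abs; have [] := ax.
Qed.

Lemma adapted_tau n x : L x -> adapted n (tau n x).
Proof. by move=> hx; split; [apply: tau_L|rewrite tower // minnn]. Qed.

Lemma adapted_const n (a : R) : 0 <= a -> adapted n (a *: fone).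
Proof.
move=> a0; have [_ ea] : fixed n (a *: fone) by apply/fixedZ/fixed_one.
by split=> //; apply/L1Z/L1_one.
Qed.

Lemma adapted0 n : adapted n 0.
Proof. by have := adapted_const n (lexx 0); rewrite scale0r. Qed.

Lemma adapted_sum n m d : (forall k, (k < m)%N -> adapted n (d k)) ->
  adapted n (\sum_(k < m) d k).
Proof.
elim: m => [|m ih] hd.
  by rewrite big_ord0; apply: adapted0.
rewrite big_ord_recr; apply: adaptedD; last exact: hd.
by apply: ih => k km; apply/hd/ltnW.
Qed.

Definition event n p := is_comp p /\ adapted n p.

Lemma event_le i j p : (i <= j)%N -> event i p -> event j p.
Proof. by move=> ij [cp ap]; split=> //; apply: adapted_le ap. Qed.

Lemma eventT n : event n fone.
Proof.
split; first exact: comp1.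
by have := adapted_const n (ler01 : 0 <= 1 :> R); rewrite scale1r.
Qed.

Lemma eventC n p : event n p -> event n (fone - p).
Proof.
move=> [cp ap]; split; first exact: compC.
by apply: adaptedB => //; have [] := eventT n.
Qed.

Lemma event_posc n x : adapted n x -> event n (posc x).
Proof.
move=> ax; have cp : is_comp (posc x) by apply: posc_comp.
split=> //.
have [_ ex] := fixed_posc (adapted_fixed ax).
by split=> //; apply: L1_comp1.
Qed.

Lemma tau_event n p x : event n p -> L x -> tau n (p ** x) = p ** tau n x.
Proof.
by move=> [cp ap] hx; apply: condU_averaging => //;
  [apply: adapted_fixed|apply: L1_filtration].
Qed.

Lemma adapted_event n p x : event n p -> adapted n x -> adapted n (p ** x).
Proof.
move=> ep [hx ex]; split; last by rewrite tau_event // ex.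
by apply: L1_comp => //; have [] := ep.
Qed.

Lemma eventI n p q : event n p -> event n q -> event n (p ** q).
Proof.
move=> ep [cq aq]; split; last exact: adapted_event.
by apply: comp_mul => //; have [] := ep.
Qed.

(** ** Martingales from their differences *)

Lemma mdiff_sum d n : mdiff (fun n => \sum_(k < n.+1) d k) n = d n.
Proof.
case: n => [|n] /=; first by rewrite big_ord1.
by rewrite [in X in X - _]big_ord_recr /= [X in X - _]addrC addrK.
Qed.

Lemma sum_mdiff (f : nat -> Eu) n : \sum_(k < n.+1) mdiff f k = f n.
Proof.
elim: n => [|n ih]; first by rewrite big_ord1.
by rewrite big_ord_recr ih /=; lin.
Qed.

Lemma martingale_sum d : (forall n, adapted n (d n)) ->
  (forall n, tau n (d n.+1) = 0) ->
  martingale iota sig T (fun n => \sum_(k < n.+1) d k).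
Proof.
move=> ad d0; have au n : adapted n (\sum_(k < n.+1) d k).
  by apply: adapted_sum => k kn; apply: adapted_le (ad k).
split=> [n|n|i j ij]; first by have [] := au n.
  by have [hu eu] := au n; exists (\sum_(k < n.+1) d k).
rewrite -(subnK ij); elim: (j - i)%N => [|m ih]; first by have [] := au i.
have [hu _] := au (m + i)%N; have [hd _] := ad (m + i).+1.
rewrite addSn big_ord_recr tauD // ih /=.
have -> : tau i (d (m + i).+1) = tau i (tau (m + i) (d (m + i).+1)).
  by rewrite tower // (minn_idPl (leq_addl _ _)).
by rewrite d0 (condU0 (S := T i)) addr0.
Qed.

End Filtration.

(** * Gundy's decomposition *)

Section Gundy.
Context {R : realType} {E : rieszType R} {e : E} {Eu : fAlgType R}.
Context {iota : {linear E -> Eu}} {Es : orderedConeType R} {sig : E -> Es}.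
Context {dcE : dedekind_complete [set: E]}
  {ucE : universal_completion e iota} {scE : sup_completion sig}.
Context {T : nat -> {linear E -> E}} {fT : filtration e T}.

Local Ltac lin := lin_over R.
Local Notation L := (L1 iota sig (T 0%N)).
Local Notation tau n := (condU iota sig (T n)).
Local Notation adapted := (adapted (iota := iota) (sig := sig) (T := T)).
Local Notation event := (event (iota := iota) (sig := sig) (T := T)).

Variables (f : nat -> Eu) (l : R) (F : Eu).
Hypothesis l0 : 0 < l.
Hypothesis mf : martingale iota sig T f.
Hypothesis fF : forall n, tau 0 (rabs (f n)) <= F.

Lemma martingale_L n : L (f n). Proof. by have [] := mf. Qed.
Lemma martingale_adapted n : adapted n (f n).
Proof. by have [hf _ ef] := mf; split=> //; apply: ef. Qed.
Lemma martingale_step n : tau n (f n.+1) = f n.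
Proof. by have [_ _ ef] := mf; apply: ef. Qed.

(** The indicator of the event [x <= l]. *)
Definition low (x : Eu) : Eu := fone - posc (x - l *: fone).

Lemma low_comp x : is_comp (low x).
Proof. by apply/compC/posc_comp. Qed.

Lemma low_le x : low x ** x <= l *: low x.
Proof. exact: poscC_le. Qed.

Lemma lowC_ge x : l *: (fone - low x) <= (fone - low x) ** x.
Proof.
have -> : fone - low x = posc (x - l *: fone) by rewrite /low; lin.
have h : 0 <= posc (x - l *: fone) ** (x - l *: fone) by apply: posc_mul_ge0.
by apply: (rle_sub h); rewrite !fmulE; lin.
Qed.

Lemma low_chebyshev x : 0 <= x -> l *: (fone - low x) <= x.
Proof.
move=> x0; apply: le_trans (lowC_ge x) _; apply: comp_mul_le => //.
exact/compC/low_comp.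
Qed.

Lemma low_event n x : adapted n x -> event n (low x).
Proof.
by move=> ax; apply/eventC/event_posc/adaptedB => //; apply/adapted_const/ltW.
Qed.

(** [before n] is the indicator of [n <= t], where [t] is the first time at
    which [rabs (f t)] exceeds [l]. *)
Fixpoint before n : Eu :=
  if n is m.+1 then before m ** low (rabs (f m)) else fone.

(** [over n] is the value of [f] at time [t] on the event [t = n]. *)
Definition over n : Eu := (before n - before n.+1) ** f n.

(** The conditional expectation of [d n] given the past; at time 0 there is no
    past, and [d 0] is left uncompensated. *)
Definition predict (d : nat -> Eu) n : Eu := if n is m.+1 then tau m (d n) else 0.

Definition compens n : Eu := \sum_(k < n.+1) predict (rabs \o over) k.

(** [running n] is the indicator of [n <= t] and [n <= s], where [s] is the
    last time before [compens] exceeds [l]. As [compens] is predictable, the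
    event is known at time [n - 1]. *)
Definition running n : Eu := before n ** low (compens n).

(** From [s] or [t] on, the increments of [f] go to the first martingale. Up to
    then only the jump at time [t] can be large; compensated, it is the increment
    of the second martingale, and the third takes the rest. *)
Definition dlate n : Eu := (fone - running n) ** mdiff f n.
Definition djump n : Eu := low (compens n) ** (over n - predict over n).
Definition dbounded n : Eu := running n ** mdiff f n - djump n.

Lemma before_comp n : is_comp (before n).
Proof.
elim: n => [|n ih] /=; first exact: comp1.
by apply: comp_mul => //; apply: low_comp.
Qed.

Lemma beforeS n : before n.+1 <= before n.
Proof.
rewrite /= -[leRHS]fmul1r; apply: comp_mono (before_comp n) _.
exact/comp_le1/low_comp.
Qed.

Lemma before_event n : event n.-1 (before n).
Proof.
elim: n => [|n ih]; first exact: eventT.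
apply: eventI; first exact: event_le (leq_pred n) ih.
exact/low_event/adapted_abs/martingale_adapted.
Qed.

Lemma before_event' n : event n (before n).
Proof. exact: event_le (leq_pred n) (before_event n). Qed.

Lemma stop_comp n : is_comp (before n - before n.+1).
Proof. exact: compB (before_comp _) (before_comp _) (beforeS n). Qed.

Lemma over_abs n : rabs (over n) = (before n - before n.+1) ** rabs (f n).
Proof. exact/comp_abs/stop_comp. Qed.

Lemma stop_event n : event n (before n - before n.+1).
Proof.
split; first exact: stop_comp.
by apply: adaptedB; [have [] := before_event' n|have [] := before_event n.+1].
Qed.

Lemma over_adapted n : adapted n (over n).
Proof. exact: adapted_event (stop_event n) (martingale_adapted n). Qed.

Lemma over_L n : L (over n). Proof. by have [] := over_adapted n. Qed.

Lemma abs_over_L n : L (rabs (over n)). Proof. exact/L1_abs/over_L. Qed.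

Lemma predict_adapted d n : (forall k, L (d k)) -> adapted n.-1 (predict d n).
Proof.
by move=> hd; case: n => [|n] /=; [apply: adapted0|apply: adapted_tau].
Qed.

Lemma compensS n : compens n.+1 = compens n + tau n (rabs (over n.+1)).
Proof. by rewrite /compens big_ord_recr. Qed.

Lemma compens_adapted n : adapted n.-1 (compens n).
Proof.
rewrite /compens; apply: adapted_sum => k kn.
have := predict_adapted k abs_over_L; apply: adapted_le.
by rewrite ltnS in kn; rewrite -!subn1 leq_sub2r.
Qed.

Lemma compens_mono n : compens n <= compens n.+1.
Proof.
rewrite compensS; have h : 0 <= tau n (rabs (over n.+1)).
  by apply: tau_ge0 (rabs_ge0 _); apply: abs_over_L.
by apply: (rle_sub h); lin.
Qed.

Lemma compens0 : compens 0 = 0.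
Proof. by rewrite /compens big_ord1. Qed.

Lemma compens_ge0 n : 0 <= compens n.
Proof.
elim: n => [|n ih]; first by rewrite compens0.
exact: le_trans ih (compens_mono n).
Qed.

Lemma low_compens_event n : event n.-1 (low (compens n)).
Proof. exact/low_event/compens_adapted. Qed.

Lemma low_compens_mono n : low (compens n.+1) <= low (compens n).
Proof.
rewrite /low; have h : posc (compens n - l *: fone) <= posc (compens n.+1 - l *: fone).
  by apply: posc_mono; apply: rler_wD2r; apply: compens_mono.
by apply: (rle_sub h); lin.
Qed.

Lemma running_event n : event n.-1 (running n).
Proof. exact: eventI (before_event n) (low_compens_event n). Qed.

Lemma running_comp n : is_comp (running n). Proof. by have [] := running_event n. Qed.

Lemma running_mono n : running n.+1 <= running n.
Proof.
rewrite /running; apply: (@le_trans _ _ (before n ** low (compens n.+1))).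
  by apply: fmul_monol (beforeS n); apply/comp_ge0/low_comp.
by apply: comp_mono (before_comp n) (low_compens_mono n).
Qed.

Lemma runningS_mul n : running n.+1 ** running n = running n.+1.
Proof.
rewrite comp_comm; last exact: running_comp.
by apply: comp_le_mul (running_mono n); apply: running_comp.
Qed.

Lemma mdiff_adapted n : adapted n (mdiff f n).
Proof.
case: n => [|n]; first exact: martingale_adapted.
by apply: adaptedB (adapted_le (leqnSn n) _); apply: martingale_adapted.
Qed.

Lemma tau_mdiff n : tau n (mdiff f n.+1) = 0.
Proof.
rewrite tauB; try exact: martingale_L.
by rewrite martingale_step; have [_ ->] := martingale_adapted n; rewrite subrr.
Qed.

Lemma martingale_transform (p : nat -> Eu) : (forall n, event n.-1 (p n)) ->
  martingale iota sig T (fun n => \sum_(k < n.+1) p k ** mdiff f k).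
Proof.
move=> ep; apply: (martingale_sum (d := fun k => p k ** mdiff f k)) => n.
  exact: adapted_event (event_le (leq_pred n) (ep n)) (mdiff_adapted n).
have [h _] := mdiff_adapted n.+1.
by rewrite (tau_event (ep n.+1)) // tau_mdiff fmul0r.
Qed.

Definition late_part n := \sum_(k < n.+1) dlate k.
Definition jump_part n := \sum_(k < n.+1) djump k.
Definition bounded_part n := \sum_(k < n.+1) dbounded k.
(** The martingale [f] stopped at the minimum of [s] and [t]. *)
Definition stopped n := \sum_(k < n.+1) running k ** mdiff f k.

Lemma late_martingale : martingale iota sig T late_part.
Proof.
apply: (martingale_transform (p := fun n => fone - running n)) => n.
exact/eventC/running_event.
Qed.

Lemma djump_adapted n : adapted n (djump n).
Proof.
apply: adapted_event; first exact: event_le (leq_pred n) (low_compens_event n).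
apply: adaptedB; first exact: over_adapted.
exact: adapted_le (leq_pred n) (predict_adapted n over_L).
Qed.

Lemma djump_L n : L (djump n). Proof. by have [] := djump_adapted n. Qed.

Lemma tau_djump n : tau n (djump n.+1) = 0.
Proof.
have hp : L (tau n (over n.+1)) by apply/tau_L/over_L.
have ho := over_L n.+1.
rewrite (tau_event (low_compens_event n.+1)); last exact: L1B ho hp.
by rewrite (tauB n ho hp) (tower n n ho) minnn subrr fmul0r.
Qed.

Lemma jump_martingale : martingale iota sig T jump_part.
Proof. by apply: martingale_sum; [apply: djump_adapted|apply: tau_djump]. Qed.

Lemma running_mdiff_L n : L (running n ** mdiff f n).
Proof. by apply: L1_comp; [apply: running_comp|have [] := mdiff_adapted n]. Qed.

Lemma bounded_martingale : martingale iota sig T bounded_part.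
Proof.
have ao n : adapted n (running n ** mdiff f n).
  exact: adapted_event (event_le (leq_pred n) (running_event n)) (mdiff_adapted n).
apply: (martingale_sum (d := dbounded)) => n.
  by apply: adaptedB; [apply: ao|apply: djump_adapted].
rewrite tauB ?tau_djump ?subr0; [|exact: running_mdiff_L|exact: djump_L].
have [h _] := mdiff_adapted n.+1.
by rewrite (tau_event (running_event n.+1)) // tau_mdiff fmul0r.
Qed.

Lemma bounded_stopped n : bounded_part n = stopped n - jump_part n.
Proof. by rewrite /bounded_part /stopped /jump_part -sumrB. Qed.

Lemma late_stopped n : late_part n = f n - stopped n.
Proof.
rewrite -(sum_mdiff f n) /late_part /stopped -sumrB; apply: eq_bigr => k _.
by rewrite /dlate fmulDlr fmulNl fmul1l.
Qed.

Lemma decomposition n : f n = late_part n + jump_part n + bounded_part n.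
Proof. by rewrite bounded_stopped late_stopped; lin. Qed.

Lemma late_L n : L (late_part n). Proof. by have [] := late_martingale. Qed.
Lemma bounded_L n : L (bounded_part n). Proof. by have [] := bounded_martingale. Qed.
Lemma stopped_L n : L (stopped n). Proof.
by apply: (L1_sum (x := fun k => running k ** mdiff f k)); apply: running_mdiff_L.
Qed.

(** ** Estimates *)

Lemma abs_martingale_L n : L (rabs (f n)). Proof. exact/L1_abs/martingale_L. Qed.

Lemma f_le_tau n : rabs (f n) <= tau n (rabs (f n.+1)).
Proof. by rewrite -{1}martingale_step; apply/tau_abs/martingale_L. Qed.

Lemma over_sum_L n : L (\sum_(k < n) rabs (over k)).
Proof. by apply: (L1_sum (x := fun k => rabs (over k))); apply: abs_over_L. Qed.

(** Optional stopping at [t]: the difference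
    [(fone - before n.+1) ** rabs (f n) - \sum_(k < n.+1) rabs (over k)] is a
    submartingale that starts at 0. *)
Lemma over_sum_le n : tau 0 (\sum_(k < n.+1) rabs (over k)) <= F.
Proof.
pose r n := (fone - before n.+1) ** rabs (f n) - \sum_(k < n.+1) rabs (over k).
have cb k : is_comp (fone - before k) by apply/compC/before_comp.
have hb k m : L ((fone - before k) ** rabs (f m)) by apply: L1_comp; [apply: cb|apply: abs_martingale_L].
suff h : 0 <= tau 0 (r n).
  have k : tau 0 ((fone - before n.+1) ** rabs (f n)) <= tau 0 (rabs (f n)).
    by apply: tau_mono => //; [apply: abs_martingale_L|apply: comp_mul_le (rabs_ge0 _)].
  move: h; rewrite tauB //; last exact: over_sum_L.
  by move=> h; apply: (rle_sub (rleD h (rleD k (fF n)))); lin.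
elim: n => [|n ih].
  have -> : r 0%N = 0 by rewrite /r big_ord1 over_abs; lin.
  by rewrite (condU0 (S := T 0%N)).
have eS : r n.+1 = (fone - before n.+1) ** rabs (f n.+1) - \sum_(k < n.+1) rabs (over k).
  by rewrite /r big_ord_recr [rabs (over _)]over_abs; move: (before n.+2) => b;
    rewrite !fmulE /=; lin.
have hr : L (r n) by apply: L1B; [apply: hb|apply: over_sum_L].
apply: le_trans ih _; rewrite -(tau0_tau n (x := r n.+1)); last first.
  by rewrite eS; apply: L1B; [apply: hb|apply: over_sum_L].
have hrS : L (r n.+1) by rewrite eS; apply: L1B; [apply: hb|apply: over_sum_L].
apply: tau_mono => //; first exact: tau_L.
rewrite eS tauB //; last exact: over_sum_L.
rewrite (tau_event (eventC (before_event n.+1)) (abs_martingale_L _)).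
have [_ ->] : adapted n (\sum_(k < n.+1) rabs (over k)).
  apply: (adapted_sum (d := fun k => rabs (over k))) => k kn.
  apply: (adapted_le (i := k)) => //; exact/adapted_abs/over_adapted.
by apply: (rle_sub (comp_mono (cb n.+1) (f_le_tau n))); rewrite /r; lin.
Qed.

Lemma compens_L n : L (compens n). Proof. by have [] := compens_adapted n. Qed.

Lemma tau0_compens n :
  tau 0 (compens n) <= tau 0 (\sum_(k < n.+1) rabs (over k)).
Proof.
elim: n => [|n ih].
  rewrite compens0 (condU0 (S := T 0%N)) big_ord1.
  by apply: tau_ge0 (rabs_ge0 _); apply: abs_over_L.
have ho := abs_over_L n.+1.
rewrite compensS (tauD 0 (compens_L n) (tau_L n ho)) (tau0_tau n ho).
rewrite big_ord_recr (tauD 0 (over_sum_L n.+1) ho).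
exact: rler_wD2r.
Qed.

Lemma compens_le n : tau 0 (compens n) <= F.
Proof. exact: le_trans (tau0_compens n) (over_sum_le n). Qed.

Definition control n := \sum_(k < n.+1) rabs (over k) + compens n.

Lemma control_L n : L (control n).
Proof. by apply: L1D; [apply: over_sum_L|apply: compens_L]. Qed.

Lemma control_le n : tau 0 (control n) <= 2 *: F.
Proof.
rewrite tauD; [|exact: over_sum_L|exact: compens_L].
by apply: (rle_sub (rleD (over_sum_le n) (compens_le n))); lin.
Qed.

Lemma before_le n : l *: (fone - before n) <= \sum_(k < n) rabs (over k).
Proof.
elim: n => [|n ih]; first by rewrite big_ord0 subrr scaler0.
rewrite big_ord_recr /= over_abs.
have h := comp_mono (before_comp n) (lowC_ge (rabs (f n))).
by apply: (rle_sub (rleD ih h)); rewrite /= !fmulE -!fmulA; lin.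
Qed.

(** The maximal inequality: the time [t] costs an overshoot of size at least
    [l], and the time [s] a compensator of size at least [l]. *)
Lemma runningC_le n : l *: (fone - running n) <= control n.
Proof.
have h1 : l *: (fone - before n) <= \sum_(k < n.+1) rabs (over k).
  apply: le_trans (before_le n) _; rewrite big_ord_recr /=.
  by apply: (rle_sub (rabs_ge0 (over n))); lin.
have h2 := low_chebyshev (compens_ge0 n).
have h3 := comp_mul_le (before_comp n)
  (rscale_ge0 (ltW l0) (comp_ge0 (compC (low_comp (compens n))))).
by apply: (rle_sub (rleD (rleD h1 h2) h3)); rewrite /control /running !fmulE; lin.
Qed.

Lemma djump_sum_le n : \sum_(k < n.+1) rabs (djump k) <= control n.
Proof.
have dvle k : rabs (djump k) <= rabs (over k) + rabs (predict over k).
  rewrite comp_abs; last exact: low_comp.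
  apply: le_trans (comp_mul_le (low_comp _) (rabs_ge0 _)) _; exact: rabsB.
rewrite /control; elim: n => [|n ih].
  by rewrite !big_ord1 compens0; apply: le_trans (dvle 0%N) _; rewrite /= rabs0.
rewrite big_ord_recr [X in _ <= X + _]big_ord_recr compensS /=.
have h : rabs (tau n (over n.+1)) <= tau n (rabs (over n.+1)).
  exact/tau_abs/over_L.
by apply: (rle_sub (rleD (rleD ih (dvle n.+1)) h)); rewrite /=; lin.
Qed.

Lemma abs_djump_L n : L (rabs (djump n)). Proof. exact/L1_abs/djump_L. Qed.

Lemma djump_sum_L n : L (\sum_(k < n) rabs (djump k)).
Proof. by apply: (L1_sum (x := fun k => rabs (djump k))); apply: abs_djump_L. Qed.

Lemma tau_djump_sum n : tau 0 (\sum_(k < n.+1) rabs (djump k)) <= 2 *: F.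
Proof.
apply: le_trans (control_le n); apply: tau_mono (djump_sum_le n).
  exact: djump_sum_L.
exact: control_L.
Qed.

Lemma stoppedS n : stopped n.+1 = stopped n + running n.+1 ** (f n.+1 - f n).
Proof. by rewrite /stopped big_ord_recr. Qed.

Lemma running_stopped n : running n.+1 ** stopped n = running n.+1 ** f n.
Proof.
elim: n => [|n ih]; first by rewrite /stopped big_ord1 fmulA runningS_mul.
have e1 : running n.+2 ** stopped n = running n.+2 ** f n.
  by rewrite -[X in X ** stopped n]runningS_mul -[LHS]fmulA ih fmulA runningS_mul.
by rewrite stoppedS [LHS]fmulDrr [X in _ + X]fmulA runningS_mul e1 !fmulE; lin.
Qed.

(** Optional stopping at the minimum of [s] and [t]: the difference
    [rabs (f n) - rabs (stopped n)] is a submartingale that starts at a positive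
    value. *)
Lemma stopped_le n : tau 0 (rabs (stopped n)) <= F.
Proof.
pose r n := rabs (f n) - rabs (stopped n).
have hs k : L (rabs (stopped k)) by apply/L1_abs/stopped_L.
have hr k : L (r k) by apply: L1B; [apply: abs_martingale_L|apply: hs].
suff h : 0 <= tau 0 (r n).
  move: h; rewrite tauB //; last exact: abs_martingale_L.
  by move=> h; apply: (rle_sub (rleD h (fF n))); lin.
elim: n => [|n ih].
  apply: tau_ge0 => //; rewrite /r /stopped big_ord1 comp_abs; last exact: running_comp.
  by apply: (rle_sub (comp_mul_le (running_comp 0) (rabs_ge0 (f 0%N)))); rewrite /=; lin.
apply: le_trans ih _; rewrite -(tau0_tau n (x := r n.+1)) //.
have co := running_comp n.+1; have c'o := compC co.
have e1 : running n.+1 ** rabs (stopped n) = running n.+1 ** rabs (f n).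
  by rewrite -!comp_abs // running_stopped.
pose z := (fone - running n.+1) ** (rabs (f n.+1) - rabs (stopped n)).
have hz0 : L (rabs (f n.+1) - rabs (stopped n)) by apply: L1B; [apply: abs_martingale_L|apply: hs].
have hz : L z by apply: L1_comp.
apply: tau_mono; [exact: hr|exact/tau_L/hr|].
apply: (@le_trans _ _ (tau n z)).
  rewrite (tau_event (eventC (running_event n.+1))) // tauB //; last exact: abs_martingale_L.
  have [_ ->] : adapted n (rabs (stopped n)).
    apply: adapted_abs; apply: (adapted_sum (d := fun k => running k ** mdiff f k)) => k kn.
    apply: (adapted_le (i := k)) => //.
    exact: adapted_event (event_le (leq_pred k) (running_event k)) (mdiff_adapted k).
  apply: (rle_sub (comp_mono c'o (f_le_tau n))).
  by rewrite /r !fmulE e1; lin.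
apply: tau_mono; [exact: hz|exact: hr|].
have h : rabs (stopped n.+1) <=
    (fone - running n.+1) ** rabs (stopped n) + running n.+1 ** rabs (f n.+1).
  have -> : stopped n.+1 = (fone - running n.+1) ** stopped n + running n.+1 ** f n.+1.
    by rewrite stoppedS !fmulE running_stopped; lin.
  by apply: le_trans (rabsD _ _) _; rewrite !comp_abs.
by apply: (rle_sub h); rewrite /z /r !fmulE; lin.
Qed.

Lemma tau_late n : tau 0 (rabs (late_part n)) <= 2 *: F.
Proof.
have h : rabs (late_part n) <= rabs (f n) + rabs (stopped n).
  by rewrite late_stopped; apply: rabsB.
have hs : L (rabs (stopped n)) by apply/L1_abs/stopped_L.
have hb : L (rabs (f n) + rabs (stopped n)) by apply: L1D; first exact: abs_martingale_L.
have ha : L (rabs (late_part n)) by apply/L1_abs/late_L.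
apply: le_trans (tau_mono 0%N ha hb h) _.
rewrite tauD //; last exact: abs_martingale_L.
by apply: (rle_sub (rleD (fF n) (stopped_le n))); lin.
Qed.

Lemma tau_bounded n : tau 0 (rabs (bounded_part n)) <= 3 *: F.
Proof.
have h1 : rabs (jump_part n) <= \sum_(k < n.+1) rabs (djump k).
  rewrite /jump_part; elim: n.+1 => [|m ih]; first by rewrite !big_ord0 rabs0.
  rewrite !big_ord_recr; apply: le_trans (rabsD _ _) _; exact: rler_wD2r.
have h : rabs (bounded_part n) <= rabs (stopped n) + \sum_(k < n.+1) rabs (djump k).
  by rewrite bounded_stopped; apply: le_trans (rabsB _ _) _; apply: rleD.
have hs : L (rabs (stopped n)) by apply/L1_abs/stopped_L.
have hb : L (rabs (stopped n) + \sum_(k < n.+1) rabs (djump k)).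
  by apply: L1D; last exact: djump_sum_L.
have ha : L (rabs (bounded_part n)) by apply/L1_abs/bounded_L.
apply: le_trans (tau_mono 0%N ha hb h) _.
rewrite tauD //; last exact: djump_sum_L.
by apply: (rle_sub (rleD (stopped_le n) (tau_djump_sum n))); lin.
Qed.

Lemma bounded_partS n : bounded_part n.+1 = bounded_part n + low (compens n.+1) **
  (before n.+2 ** f n.+1 - before n.+1 ** f n + tau n (over n.+1)).
Proof.
have -> : bounded_part n.+1 = bounded_part n + dbounded n.+1 by rewrite /bounded_part big_ord_recr.
rewrite /dbounded /running /djump [predict over n.+1]/= [mdiff f n.+1]/=.
move: (bounded_part n) (tau n _) => y x.
rewrite /over; move: (before n.+2) (before n.+1) (low (compens n.+1)) (low_comp (compens n.+1)).
move=> b b' c cc; rewrite -(comp_comm b' cc) -!fmulA !fmulE; lin.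
Qed.

(** Until time [s] the martingale [bounded_part] differs from the truncation
    [before n.+1 ** f n] by a compensator of size at most [compens n]; both
    are bounded by [l] there, and afterwards [bounded_part] is constant. *)
Lemma bounded_part_le n : rabs (bounded_part n) <= (2 * l) *: fone.
Proof.
pose c n := low (compens n); pose a n := before n.+1 ** f n.
have cc k : is_comp (c k) by apply: low_comp.
have ca k : c k.+1 ** c k = c k.+1.
  by rewrite comp_comm // comp_le_mul //; apply: low_compens_mono.
have aE k : rabs (a k) <= l *: fone.
  rewrite /a comp_abs; last exact: before_comp.
  rewrite [before _]/= -fmulA; apply: le_trans (comp_mono (before_comp k) (low_le _)) _.
  rewrite fmulZr; apply: rle_scale; first exact: ltW.
  by apply/comp_le1/comp_mul; [apply: before_comp|apply: low_comp].
suff [] : rabs (bounded_part n) <= (2 * l) *: fone /\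
    c n ** rabs (bounded_part n - a n) <= c n ** compens n by [].
elim: n => [|n [ih1 ih2]].
  have e0 : bounded_part 0 = c 0%N ** a 0%N.
    rewrite /bounded_part big_ord1 /dbounded /running /djump /over /predict /mdiff /a -/(c 0%N).
    by move: (before 1) (c 0%N) => b q; rewrite /= !fmulE; lin.
  split; rewrite e0.
    rewrite comp_abs //; apply: le_trans (comp_mul_le (cc _) (rabs_ge0 _)) _.
    apply: le_trans (aE 0%N) _; apply: rle_scalel; rewrite ?fone_ge0 //.
    by move: l0; lra.
  rewrite -comp_abs // fmulDrr fmulA comp_idem // fmulNr subrr rabs0.
  exact: comp_mul_ge0 (cc _) (compens_ge0 _).
have gE : bounded_part n.+1 = bounded_part n + c n.+1 ** (a n.+1 - a n + tau n (over n.+1)).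
  exact: bounded_partS.
have h2 : c n.+1 ** rabs (bounded_part n.+1 - a n.+1) <= c n.+1 ** compens n.+1.
  have h3 := comp_mono (cc n.+1) ih2; rewrite !fmulA ca in h3.
  have h4 : rabs (tau n (over n.+1)) <= tau n (rabs (over n.+1)).
    exact/tau_abs/over_L.
  have {}h4 := comp_mono (cc n.+1) h4.
  have h5 : rabs (c n.+1 ** (bounded_part n.+1 - a n.+1)) <=
      c n.+1 ** rabs (bounded_part n - a n) + c n.+1 ** rabs (tau n (over n.+1)).
    have -> : c n.+1 ** (bounded_part n.+1 - a n.+1) =
        c n.+1 ** (bounded_part n - a n) + c n.+1 ** tau n (over n.+1).
      rewrite gE; move: (c n.+1) (cc n.+1) (tau n _) (a n) (a n.+1) => q cq x y y'.
      by rewrite !fmulE !fmulA !comp_idem //; lin.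
    by apply: le_trans (rabsD _ _) _; rewrite !comp_abs.
  rewrite -comp_abs // compensS fmulDrr.
  by apply: le_trans h5 _; apply: rleD.
split=> //; apply: (comp_split_le (cc n.+1)).
  have h3 : rabs (bounded_part n.+1) <= rabs (bounded_part n.+1 - a n.+1) + rabs (a n.+1).
    have {1}-> : bounded_part n.+1 = (bounded_part n.+1 - a n.+1) + a n.+1 by lin.
    exact: rabsD.
  have h4 := comp_mono (cc n.+1) (aE n.+1).
  have h5 := low_le (compens n.+1).
  apply: (rle_sub (rleD (rleD (comp_mono (cc n.+1) h3) h4) (rleD h2 h5))).
  by rewrite /c !fmulE; lin.
have c'c := compC (cc n.+1).
rewrite -comp_abs //.
have -> : (fone - c n.+1) ** bounded_part n.+1 = (fone - c n.+1) ** bounded_part n.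
  rewrite gE; move: (c n.+1) (cc n.+1) (_ + tau n _) => q cq x.
  by rewrite !fmulE !fmulA !comp_idem //; lin.
by rewrite comp_abs //; apply: comp_mono.
Qed.

(** ** Suprema and squares *)

Lemma runningC_nondecreasing n : fone - running n <= fone - running n.+1.
Proof. by apply: (rle_sub (running_mono n)); lin. Qed.

Lemma runningC_supremum : exists q,
  [/\ is_comp q, forall n, fone - running n <= q, L q & l *: tau 0 q <= 2 *: F].
Proof.
have [||q sq] := @supremum_exists _ _ _ (range (fun n => fone - running n)) fone.
- by exists (fone - running 0%N), 0%N.
- by move=> _ [n _ <-]; apply/comp_le1/compC/running_comp.
suff [hq tq] : L q /\ tau 0 q <= l^-1 *: (2 *: F).
  exists q; split=> //; last by rewrite rle_scaleV.
    apply: comp_supremums sq; first by exists (fone - running 0%N), 0%N.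
    by move=> _ [n _ <-]; apply/compC/running_comp.
  by move=> n; have [us _] := sq; apply: us; exists n.
apply: (condU_supremums _ _ _ sq).
- by exists (fone - running 0%N), 0%N.
- exact: upward_nondecreasing runningC_nondecreasing.
- by move=> _ [n _ <-]; apply/comp_ge0/compC/running_comp.
- move=> _ [n _ <-]; have ho : L (fone - running n) by apply/L1_comp1/compC/running_comp.
  split=> //; rewrite -rle_scaleV // -(condUZ_gt0 (S := T 0%N) l0 ho).
  apply: le_trans (control_le n); apply: tau_mono (runningC_le n).
    exact: L1Z.
  exact: control_L.
Qed.

Lemma late_disjoint q n : is_comp q -> fone - running n <= q ->
  rmeet (rabs (dlate n)) (fone - q) = 0.
Proof.
move=> cq oq; have c'o := compC (running_comp n).
rewrite /dlate comp_abs //.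
apply: disjoint_le (comp_fmul_disjoint c'o (rabs_ge0 (mdiff f n))) => //.
- exact: comp_mul_ge0 c'o (rabs_ge0 _).
- exact/comp_ge0/compC.
- by apply: (rle_sub oq); lin.
Qed.

(** The partial sums have bounded expectations, hence a supremum by monotone
    convergence. *)
Lemma djump_supremum : exists s,
  [/\ supremums (range (fun n => \sum_(k < n.+1) rabs (djump k))) s, L s &
      tau 0 s <= 2 *: F].
Proof.
pose z n := \sum_(k < n.+1) rabs (djump k).
have zn : range z !=set0 by exists (z 0%N), 0%N.
have uz : upward (range z).
  apply: upward_nondecreasing => n; rewrite /z [leRHS]big_ord_recr /=.
  by apply: (rle_sub (rabs_ge0 (djump n.+1))); lin.
have z0 x : range z x -> 0 <= x.
  move=> [n _ <-]; rewrite /z; elim: n.+1 => [|m ih]; first by rewrite big_ord0.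
  by rewrite big_ord_recr raddr_ge0 ?rabs_ge0.
have hz x : range z x -> L x /\ tau 0 x <= 2 *: F.
  by move=> [n _ <-]; split; [apply: djump_sum_L|apply: tau_djump_sum].
have [b ub] := condU_bounded zn uz z0 hz.
have [s ss] := @supremum_exists _ _ _ (range z) b zn ub.
have [hs ts] := condU_supremums zn uz z0 ss hz.
by exists s.
Qed.

(** [rabs (bounded_part n)] is bounded by [2 * l], which gives both a linear
    and a constant bound of its square. *)
Lemma bounded_part_sq n :
  [/\ L (fsq (rabs (bounded_part n))),
      tau 0 (fsq (rabs (bounded_part n))) <= (6 * l) *: F &
      tau 0 (fsq (rabs (bounded_part n))) <= (2 * l) ^+ 2 *: fone].
Proof.
set x := rabs (bounded_part n); have x0 : 0 <= x by apply: rabs_ge0.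
have hx : L x by apply/L1_abs/bounded_L.
have a0 : 0 < 2 * l by rewrite mulr_gt0.
have xa : x <= (2 * l) *: fone by apply: bounded_part_le.
have sqx : fsq x <= (2 * l) *: x.
  by apply: le_trans (fmul_monor x0 xa) _; rewrite !fmulE.
have h2 : L ((2 * l) *: x) by apply: L1Z.
have hsq : L (fsq x).
  by apply: (L1_le _ h2); rewrite !rabs_ge ?rscale_ge0 ?fmul_ge // ltW.
have e2 : tau 0 ((2 * l) *: x) = (2 * l) *: tau 0 x by apply: condUZ_gt0.
have tsq : tau 0 (fsq x) <= (2 * l) *: tau 0 x by rewrite -e2; apply: tau_mono.
split=> //; apply: le_trans tsq _.
  have -> : (6 * l) *: F = (2 * l) *: (3 *: F) by lin.
  by apply: rle_scale; [apply: ltW|apply: tau_bounded].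
rewrite expr2 -[leRHS]scalerA; apply: rle_scale; first exact: ltW.
have [h3 <-] := adapted_const 0 (ltW a0).
exact: tau_mono.
Qed.

End Gundy.

(** * Norms in the sup-completion *)

Section Norms.
Context {R : realType} {E : rieszType R} {e : E} {Eu : fAlgType R}.
Context {iota : {linear E -> Eu}} {Es : orderedConeType R} {sig : E -> Es}.
Context {dcE : dedekind_complete [set: E]}
  {ucE : universal_completion e iota} {scE : sup_completion sig}.
Implicit Types (g h : E) (x y z q F : Eu) (r : Es).

Local Ltac lin := lin_over R.
Local Notation u2s := (u2s iota sig).

Lemma u2s_le_scale (c : R) x F r : 0 < c -> 0 <= x -> 0 <= F -> x <= c *: F ->
  u2s F <= r -> u2s x <= cscale c r.
Proof.
move=> c0 x0 F0 xF Fr; apply: (@le_trans _ _ (u2s (c *: F))).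
  by rewrite u2s_le // rscale_ge0 // ltW.
by apply: le_trans (u2s_scale c0 F0) _; apply: cle_scale => //; apply: ltW.
Qed.

(** The negative part of [h] is below both [rabs h] and [rabs g]. *)
Lemma riesz_disjoint_ge0 g h : 0 <= g + h -> rmeet (rabs g) (rabs h) = 0 -> 0 <= h.
Proof.
move=> gh0 gh; suff n0 : rneg h <= 0.
  by rewrite (rpos_neg h); apply: (rle_sub (rleD n0 (rpos_ge0 h))); lin.
rewrite -gh; apply: rmeet_glb (rneg_le_abs h).
apply: rpos_le (rabs_ge0 g); apply: le_trans (rle_abs g).
by apply: (rle_sub gh0); lin.
Qed.

(** An element of [E] below the supremum of the [x n] is approximated by its
    meets with elements below one of them, so it inherits disjointness. *)
Lemma supS_disjoint (x : nat -> Eu) q g : (forall n, 0 <= x n) -> 0 <= q ->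
  q <= fone -> (forall n, rmeet (x n) q = 0) -> 0 <= g ->
  sig g <= supS (fun n => u2s (x n)) -> rmeet (iota g) q = 0.
Proof.
move=> x0 q0 q1 xq g0 gx; have ig0 : 0 <= iota g by rewrite iota_ge0.
have m0 := rmeet_ge0 ig0 q0.
have [m m_ge0 mE] := iota_solid m0 (rmeetl _ _).
pose A := [set a | exists n, iota a <= x n].
have A0 : A !=set0 by exists 0, 0%N; rewrite linear0.
have sA : supremums (sig @` A) (supS (fun n => u2s (x n))).
  split=> [_ [a [n an] <-]|t ut].
    apply: le_trans (u2s_le_supS (iota := iota) (sig := sig) x n).
    by rewrite sig_le_u2s.
  apply: supS_le => n; apply: u2s_lub_le => // h _ hx.
  by apply: ut; exists h => //; exists n.
have mx : sig m <= supS (fun n => u2s (x n)).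
  by apply: le_trans gx; rewrite sig_le -(iota_le (iota := iota)) mE rmeetl.
have [_ lm] := sup_completion_meet scE A0 sA mx.
apply: le_anti; rewrite m0 andbT -mE -(linear0 iota) iota_le -(sig_le (sig := sig)).
apply: lm => _ [a [n an] <-]; rewrite sig_le -(iota_le (iota := iota)).
rewrite iota_meet linear0 mE -(xq n) rmeetC.
by apply: rmeet_mono an (rmeetr _ _).
Qed.

Lemma band_fmul_eq0 q : is_comp q -> band [set h : E | q ** iota h = 0].
Proof.
move=> cq; split=> [|D s Ds sD /=].
  split=> [|a x y hx hy|x y hy xy] /=.
  - by rewrite linear0 fmul0r.
  - by rewrite linearD linearZZ fmulDrr fmulZr hx hy scaler0 addr0.
  - apply: rabs_eq0; have e0 : q ** rabs (iota y) = 0 by rewrite -comp_abs // hy rabs0.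
    by rewrite comp_abs // -e0 -!iota_abs; apply: comp_mono; rewrite ?iota_le.
have [us ls] := comp_mul_supremums cq (iota_supremums sD).
apply: le_anti; apply/andP; split.
  by apply: ls => _ [_ [d Dd <-] <-]; rewrite (Ds d Dd).
(* The supremum of the empty set is the least element of [E], which is 0. *)
have [D0|/set0P[d Dd]] := eqVneq D set0.
  suff s0 : 0 <= s by apply: comp_mul_ge0 => //; rewrite iota_ge0.
  have [_ l] := sD; have : s <= s + s by apply: l; rewrite D0.
  by move=> h; apply: (rle_sub h); lin.
by apply: us; exists (iota d); [exists d|rewrite (Ds d Dd)].
Qed.

(** The elements of [E] annihilated by [fone - q] form a band, which contains
    the band generated by the elements below the supremum of the [x n]; and
    [b] and [e - b] are positive, being disjoint with a positive sum. *)
Lemma band_projS_le (x : nat -> Eu) q : (forall n, 0 <= x n) -> is_comp q ->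
  (forall n, rmeet (x n) (fone - q) = 0) -> 0 <= e ->
  let b := band_projS sig (supS (fun n => u2s (x n))) e in
  0 <= b /\ iota b <= q.
Proof.
move=> x0 cq xq e0; rewrite /= /band_projS /band_proj.
(* The default value 0 satisfies both bounds. *)
set B := band_generated _; case: xgetP => [b _ [Bb eb]|_]; last first.
  by rewrite linear0; split=> //; apply: comp_ge0.
have c'q := compC cq.
have qb : (fone - q) ** iota b = 0.
  apply: (Bb _ (band_fmul_eq0 c'q)) => g [g0 gx] /=.
  rewrite comp_comm //; apply/fmul_disjoint/(supS_disjoint x0) => //.
  - exact: comp_ge0.
  - exact: comp_le1.
have dis : rmeet (rabs (e - b)) (rabs b) = 0 by apply: eb.
have b0 : 0 <= b.
  by apply: riesz_disjoint_ge0 dis; have -> : e - b + b = e by lin.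
have be : iota b <= fone.
  rewrite -(iota_e (iota := iota)) iota_le.
  have h : 0 <= e - b.
    apply: (@riesz_disjoint_ge0 b); first by have -> : b + (e - b) = e by lin.
    by rewrite rmeetC.
  by apply: (rle_sub h); lin.
split=> //; have -> : iota b = q ** iota b.
  by move: qb; rewrite !fmulE => /eqP; rewrite subr_eq0 => /eqP.
by rewrite -[leRHS]fmul1r; apply: comp_mono.
Qed.

(** On the event [y > a] both factors of [(y - a) (y + a)] are positive. *)
Lemma sq_le_unit (a : R) y : 0 < a -> 0 <= y -> y ** y <= a ^+ 2 *: fone ->
  y <= a *: fone.
Proof.
move=> a0 y0 yy; set z := y - a *: fone; set c := posc z.
have cc : is_comp c by apply: posc_comp.
suff h : rpos z = 0 by apply: (rle_sub (rpos0_le h)); rewrite /z; lin.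
apply: le_anti; rewrite rpos_ge0 andbT.
have cz : 0 <= c ** z by apply: posc_mul_ge0.
have h1 := fmul_ge cz y0; have h2 := comp_mono cc yy.
have cE : c ** z = rpos z by apply: posc_mul.
suff k : a *: (c ** z) <= a *: 0 by rewrite -cE; move: k; rewrite rle_scaleV // scalerA mulVf ?gt_eqF // scale1r.
by apply: (rle_sub (rleD h1 h2)); rewrite /z expr2 !fmulE !fmulA; lin.
Qed.

Lemma sqrtU_le x : 0 <= x -> 0 <= sqrtU x /\ fsq (sqrtU x) <= x.
Proof.
(* Where [x] has no square root, [sqrtU x] is 0. *)
move=> x0; rewrite /sqrtU; case: xgetP => [y _ [y0 <-]|_] //.
by rewrite /fsq fmul0l.
Qed.

Lemma sqS_le (y : nat -> Eu) (a : R) z : 0 < a -> 0 <= z ->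
  (forall n, [/\ 0 <= y n, y n <= a *: fone & fsq (y n) <= z]) ->
  sqS iota sig (supS (fun n => u2s (y n))) <= u2s z.
Proof.
move=> a0 z0 hy; have yn : range y !=set0 by exists (y 0%N), 0%N.
have [||s ss] := @supremum_exists _ _ _ (range y) (a *: fone) => //.
  by move=> _ [n _ <-]; have [] := hy n.
have sz : s ** s <= z.
  by apply: (sq_supremums_le a0 yn _ ss) => _ [n _ <-]; apply: hy.
have us n : y n <= s by have [us _] := ss; apply: us; exists n.
have s0 : 0 <= s by have [h _ _] := hy 0%N; apply: le_trans h (us 0%N).
have ys : supS (fun n => u2s (y n)) <= u2s s.
  by apply: supS_le => n; rewrite u2s_le //; have [] := hy n.
rewrite /sqS; set D := [set _ | _ in _].
have Dn : D !=set0.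
  exists (u2s (fsq (iota 0))), 0 => //; split=> //.
  apply: (@le_trans _ _ (u2s (y 0%N))); last exact: (u2s_le_supS y 0%N).
  by have [h _ _] := hy 0%N; rewrite sig_le_u2s // linear0.
have [_ ls] := supremum_Es Dn; apply: ls => _ [g [g0 gy] <-].
have ig0 : 0 <= iota g by rewrite iota_ge0.
have gs : iota g <= s by rewrite -(sig_le_u2s (sig := sig)) // (le_trans gy).
rewrite u2s_le ?fmul_ge //; apply: le_trans sz.
exact: le_trans (fmul_monor ig0 gs) (fmul_monol s0 gs).
Qed.

Lemma normoo_le (T0 : E -> E) x F : 0 <= F -> condU_range iota sig T0 T0 F ->
  rabs x <= F -> 0 <= normoo iota sig T0 x /\ normoo iota sig T0 x <= F.
Proof.
move=> F0 hF xF; rewrite /normoo /infimum; case: ifPn => // _.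
case: xgetP => // y _ [ly uy]; split; last by apply: ly.
by apply: uy => z [_ xz]; apply: le_trans (rabs_ge0 x) xz.
Qed.

Lemma u2s_supremums_in (T0 : E -> E) (x : nat -> Eu) F :
  (forall x y, 0 <= x -> x <= y -> L1 iota sig T0 y -> L1 iota sig T0 x) ->
  (forall n, 0 <= x n) -> supremums_in (L1 iota sig T0) (range x) F ->
  [/\ 0 <= F, forall n, x n <= F & u2s F <= supS (fun n => u2s (x n))].
Proof.
move=> L1le x0 [hF [uF lF]].
have xF n : x n <= F by apply: uF; exists n.
have F0 : 0 <= F by apply: le_trans (x0 0%N) (xF 0%N).
split=> //; apply: (@u2s_lub _ _ _ _ _ _ _ _ _ _ (range x)).
- by exists (x 0%N), 0%N.
- by move=> _ [n _ <-].
- split=> // t ut; apply: le_trans (rmeetl t F).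
  have tn n : x n <= rmeet t F by apply: rmeet_glb => //; apply: ut; exists n.
  apply: lF; last by move=> _ [n _ <-].
  apply: (L1le _ F) => //; last exact: rmeetr.
  exact: le_trans (x0 0%N) (tn 0%N).
- by move=> _ [n _ <-]; apply: (u2s_le_supS x n).
Qed.

End Norms.

(** * The decomposition theorem *)

Theorem theorem4p5 (R : realType) :
  exists C : R, 0 < C /\
  forall (E : rieszType R) (e : E)
    (Eu : fAlgType R) (iota : {linear E -> Eu})
    (Es : orderedConeType R) (sig : E -> Es)
    (T : nat -> {linear E -> E}) (f : nat -> Eu),
  dedekind_complete [set: E] -> weak_order_unit e ->
  universal_completion e iota -> sup_completion sig ->
  filtration e T ->
  martingale iota sig T f -> L1_bounded iota sig (T 0%N) f ->
  let T1 : E -> E := T 0%N in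
  let normf1 := mnorm iota sig (norm1 iota sig T1) f in
  forall lambda : R, 0 < lambda ->
  exists u v w : nat -> Eu,
    [/\ martingale iota sig T u, martingale iota sig T v,
        martingale iota sig T w & forall n, f n = u n + v n + w n] /\
    [/\ L1_bounded iota sig T1 u,
        mnorm iota sig (norm1 iota sig T1) u <= cscale C normf1 &
        cscale lambda (sig (T1 (band_projS sig (mdiff_max iota sig u) e)))
          <= cscale C normf1] /\
    (exists s : Eu,
      [/\ forall n, v n = \sum_(k < n.+1) mdiff v k,
          absolutely_cvg_to iota sig T1 v s &
          u2s iota sig (norm1 iota sig T1 s) <= cscale C normf1]) /\
    [/\ forall n, Loo iota sig T1 (w n),
        mnorm iota sig (normoo iota sig T1) w <= sig ((C * lambda) *: e),
        mnorm iota sig (norm1 iota sig T1) w <= cscale C normf1,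
        forall n, L2 iota sig T1 (w n) &
        sqS iota sig (mnorm iota sig (norm2 iota sig T1) w)
          <= cscale (C * lambda) normf1].
Proof.
(* The norm bounds hold with 2 for the first two martingales and 3 for the
   third; 6 comes from the square of the third, which is at most its absolute
   value times [2 * lambda]. *)
exists 6; split=> [|E e Eu iota Es sig T f dcE wuE ucE scE fT mf [F FP] T1 normf1 l l0].
  by rewrite ltr0n.
have hf n : L1 iota sig T1 (f n) by apply: martingale_L mf n.
have raf0 n : 0 <= norm1 iota sig T1 (f n).
  by apply: (condU_ge0 (S := T 0%N) (rabs_ge0 _)); apply/(L1_abs (S := T 0%N)).
have L1le (x y : Eu) : 0 <= x -> x <= y -> L1 iota sig T1 y -> L1 iota sig T1 x.
  move=> x0 xy; apply: (L1_le (S := T 0%N)).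
  by rewrite !rabs_ge // (le_trans x0).
have [F0 fF uF] := u2s_supremums_in L1le raf0 FP.
have hF : L1 iota sig T1 F by case: FP.
rewrite -/(mnorm iota sig (norm1 iota sig T1) f) -/normf1 in uF.
have e0 : 0 <= e by have [/ltW] := wuE.
have bnd (c : R) (x : Eu) : 0 < c -> 0 <= x -> x <= c *: F ->
    u2s iota sig x <= cscale c normf1.
  by move=> c0 x0 xF; apply: (u2s_le_scale c0 x0 F0 xF uF).
have c6 : (0 : R) < 6 by rewrite ltr0n.
have bnd6 (c : R) (x : Eu) : c <= 6 -> 0 <= x -> x <= c *: F ->
    u2s iota sig x <= cscale 6 normf1.
  by move=> cc x0 xF; apply: bnd => //; apply: le_trans xF _; apply: rle_scalel.
have le26 : (2 : R) <= 6 by rewrite ler_nat.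
have le36 : (3 : R) <= 6 by rewrite ler_nat.
pose u := late_part (iota := iota) (sig := sig) (T := T) f l; pose v := jump_part (iota := iota) (sig := sig) (T := T) f l.
pose w := bounded_part (iota := iota) (sig := sig) (T := T) f l.
have mu : martingale iota sig T u by apply: late_martingale.
have mv : martingale iota sig T v by apply: jump_martingale.
have mw : martingale iota sig T w by apply: bounded_martingale.
have norm_ge0 z n : martingale iota sig T z -> 0 <= norm1 iota sig T1 (z n).
  move=> mz; apply: (condU_ge0 (S := T 0%N) (rabs_ge0 _)).
  by apply/(L1_abs (S := T 0%N)); have [] := mz.
exists u, v, w; split; [|split; [|split]].
- by split=> // n; apply: decomposition.
- have un n : norm1 iota sig T1 (u n) <= 2 *: F by apply: tau_late.
  split.
  + have [||s ss] := @supremum_exists _ _ _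
      (range (fun n => norm1 iota sig T1 (u n))) (2 *: F).
    * by exists (norm1 iota sig T1 (u 0%N)), 0%N.
    * by move=> _ [n _ <-].
    have [us ls] := ss; exists s; split; last by split=> // t _; apply: ls.
    apply: (L1le _ (2 *: F)).
    * by apply: le_trans (us _ _); [apply: (norm_ge0 u 0%N)|exists 0%N].
    * by apply: ls => _ [n _ <-].
    * exact: (L1Z (S := T 0%N)).
  + by apply: supS_le => n; apply: (bnd6 2) => //; apply: norm_ge0.
  + have [q [cq oq hq tq]] := runningC_supremum l0 mf fF.
    have mdE n : mdiff u n = dlate (iota := iota) (sig := sig) (T := T) f l n by apply: mdiff_sum.
    have [||b0 bq] := @band_projS_le _ _ _ _ _ _ _ _ _ _
      (fun n => rabs (mdiff u n)) q _ cq _ e0.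
    * by move=> n; apply: rabs_ge0.
    * by move=> n; rewrite mdE; apply: late_disjoint.
    set b := band_projS _ _ _ in b0 bq *.
    have Tb0 : 0 <= T1 b by apply: (ce_ge0 (S := T 0%N)).
    rewrite -(sup_completionZ scE _ (ltW l0)) -(u2s_iota (iota := iota)).
    * apply: (bnd6 2) => //.
      by rewrite iota_ge0 rscale_ge0 // ltW.
      rewrite linearZZ -(condU_iota (S := T 0%N)) //; apply: le_trans tq.
      apply: rle_scale; first exact: ltW.
      by apply: tau_mono => //; apply: (L1_iota (S := T 0%N)).
    * by rewrite rscale_ge0 // ltW.
- have [s [ss hs ts]] := djump_supremum l0 mf fF.
  have mdE n : mdiff v n = djump (iota := iota) (sig := sig) (T := T) f l n by apply: mdiff_sum.
  exists s; split.
  + by move=> n; rewrite sum_mdiff.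
  + have [us ls] := ss; pose z n := \sum_(k < n.+1) rabs (mdiff v k).
    have zE n : z n = \sum_(k < n.+1) rabs (djump (iota := iota) (sig := sig) (T := T) f l k).
      by apply: eq_bigr => k _; rewrite mdE.
    have zs n : z n <= s by apply: us; exists n.
    have hz n : L1 iota sig T1 (z n) by rewrite zE; apply: djump_sum_L.
    split=> //; exists (fun n => s - z n); split.
    * by move=> n; apply: (L1B (S := T 0%N)).
    * move=> i j ij; suff k : z i <= z j by apply: (rle_sub k); lin_over R.
      rewrite -(subnK ij); elim: (j - i)%N => // m ih; apply: le_trans ih _; rewrite addSn.
      by rewrite /z [leRHS]big_ord_recr /=; apply: (rle_sub (rabs_ge0 (mdiff v (m + i).+1))); lin_over R.
    * split; first exact: (L1_0 (S := T 0%N)).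
      split=> [_ [n _ <-]|t _ lt]; first by apply: (rle_sub (zs n)); lin_over R.
      suff k : s <= s - t by apply: (rle_sub k); lin_over R.
      apply: ls => _ [n _ <-]; have k : t <= s - z n by apply: lt; exists n.
      by rewrite -zE; apply: (rle_sub k); lin_over R.
    * move=> n; rewrite -/(z n) -rabsN opprB rabs_ge //.
      by apply: (rle_sub (zs n)); lin_over R.
  + have s0 : 0 <= s.
      have [us _] := ss; apply: le_trans (us _ (ex_intro2 _ _ 0%N I erefl)).
      by rewrite big_ord1 rabs_ge0.
    rewrite /norm1 rabs_ge //; apply: (bnd6 2) => //.
    exact: (condU_ge0 (S := T 0%N)).
- have ll0 : 0 < 2 * l by rewrite mulr_gt0.
  have [h2l e2l] : adapted (iota := iota) (sig := sig) (T := T) 0 ((2 * l) *: fone).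
    by apply/adapted_const/ltW.
  have r2l : condU_range iota sig T1 T1 ((2 * l) *: fone) by exists ((2 * l) *: fone).
  have p2l : 0 <= (2 * l) *: (fone : Eu) by rewrite rscale_ge0 ?fone_ge0 ?ltW.
  have wb n : rabs (w n) <= (2 * l) *: fone by apply: bounded_part_le.
  have wsq n : [/\ L1 iota sig T1 (fsq (rabs (w n))),
      condU iota sig T1 (fsq (rabs (w n))) <= (6 * l) *: F &
      condU iota sig T1 (fsq (rabs (w n))) <= (2 * l) ^+ 2 *: fone].
    exact: bounded_part_sq.
  split.
  + move=> n; split; first by have [] := mw.
    by exists ((2 * l) *: fone).
  + have ce : 0 <= (6 * l) *: e by rewrite rscale_ge0 // mulr_ge0 // ltW.
    apply: supS_le => n; rewrite -(u2s_iota (iota := iota)) //.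
    have [n0 n1] := normoo_le p2l r2l (wb n).
    rewrite u2s_le ?iota_ge0 //; apply: le_trans n1 _.
    rewrite linearZZ iota_e; apply: rle_scalel; rewrite ?fone_ge0 //.
    by rewrite ler_pM2r.
  + by apply: supS_le => n; apply: (bnd6 3) => //; [apply: norm_ge0|apply: tau_bounded].
  + by move=> n; split; [have [] := mw|have [] := wsq n].
  + have lF : 0 <= (6 * l) *: F by rewrite rscale_ge0 // mulr_ge0 // ltW.
    have l6 : 0 < 6 * l by rewrite mulr_gt0.
    apply: le_trans (sqS_le ll0 lF _) (bnd _ _ l6 lF (lexx _)).
    move=> n; have [hq tq1 tq2] := wsq n.
    have q0 : 0 <= condU iota sig T1 (fsq (rabs (w n))).
      by apply: (condU_ge0 (S := T 0%N)) => //; apply: fmul_ge; apply: rabs_ge0.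
    have [n0 n1] := sqrtU_le q0; split=> //; last exact: le_trans n1 tq1.
    by apply: sq_le_unit => //; apply: le_trans n1 tq2.
Qed.
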